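(* Let $G$ and $H$ be finite groups acting on each other compatibly. Suppose that $G$ is one of the following groups: (i) a metacyclic group; (ii) the symmetric group $S_n$ on $n$ letters for $n=5$ or $n\geq 8$; (iii) a simple group with $M(G)=0$ or $M(G)\cong\mathbb{Z}/2\mathbb{Z}$. Then $B_0(G\otimes H)=0$, where $G\otimes H$ is the non-abelian tensor product.
   Context: For a finite group $K$, the Bogomolov multiplier is $B_0(K)=\operatorname{Ker}\{H^2(K,\mathbb{Q}/\mathbb{Z})\to\bigoplus_A H^2(A,\mathbb{Q}/\mathbb{Z})\}$ (restriction maps, trivial action on $\mathbb{Q}/\mathbb{Z}$), where $A$ runs over all abelian subgroups of $K$. $M(G)=H_2(G,\mathbb{Z})$ is the Schur multiplier. A group is metacyclic if it is an extension of a cyclic group by a cyclic group. Groups act on themselves by conjugation on the left: ${}^{g}g'=gg'g^{-1}$. Let $G$ act on $H$ and $H$ act on $G$ by automorphisms (left actions, written ${}^{g}h$ and ${}^{h}g$). The mutual actions are compatible if ${}^{({}^{h}g)}h'={}^{hgh^{-1}}h'$ and ${}^{({}^{g}h)}g'={}^{ghg^{-1}}g'$ for all $g,g'\in G$, $h,h'\in H$, where ${}^{hgh^{-1}}h'$ means $h\cdot {}^{g}(h^{-1}h'h)\cdot h^{-1}$ and ${}^{ghg^{-1}}g'$ means $g\cdot {}^{h}(g^{-1}g'g)\cdot g^{-1}$. For compatible actions, the non-abelian tensor product $G\otimes H$ is the group generated by symbols $g\otimes h$ ($g\in G$, $h\in H$) with relations $gg'\otimes h=({}^{g}g'\otimes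 {}^{g}h)(g\otimes h)$ and $g\otimes hh'=(g\otimes h)({}^{h}g\otimes {}^{h}h')$ for all $g,g'\in G$, $h,h'\in H$. (It is a known result that $G\otimes H$ is finite when $G$ and $H$ are finite.) *)

(* Defs.v *)
From HB Require Import structures.
From mathcomp Require Import all_boot all_order all_algebra.
From mathcomp Require Import all_fingroup all_solvable.
From mathcomp Require Import boolp classical_sets functions.
From mathcomp Require Import generic_quotient ring_quotient.

Set Implicit Arguments.
Unset Strict Implicit.
Unset Printing Implicit Defensive.

Import GRing.Theory.

Local Open Scope quotient_scope.
Local Open Scope ring_scope.

Section Homology.
Variables (A B C : zmodType) (f : {additive A -> B}) (g : {additive B -> C}).

Definition is_cycle : {pred B} := fun b => g b == 0.

Lemma is_cycle_zmod_closed : zmod_closed is_cycle.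
Proof.
split=> [|x y]; rewrite !unfold_in; first by rewrite raddf0.
by rewrite raddfB => /eqP-> /eqP->; rewrite subr0.
Qed.
HB.instance Definition _ :=
  GRing.isZmodClosed.Build B is_cycle is_cycle_zmod_closed.

Definition cycles : Type := {b : B | is_cycle b}.
HB.instance Definition _ := SubChoice.on cycles.
HB.instance Definition _ := [SubChoice_isSubZmodule of cycles by <:].

Definition is_boundary : {pred cycles} :=
  fun z => `[< exists a, f a = val z >].

Lemma is_boundary_zmod_closed : zmod_closed is_boundary.
Proof.
split=> [|x y]; first by apply/asboolP; exists 0; rewrite !raddf0.
move=> /asboolP[a fa] /asboolP[b fb]; apply/asboolP; exists (a - b).
by rewrite !raddfB fa fb.
Qed.
HB.instance Definition _ :=
  GRing.isZmodClosed.Build cycles is_boundary is_boundary_zmod_closed.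

(* The homology (ker g / im f) at B of A --f--> B --g--> C. *)
Definition homology : Type := Quotient.quot is_boundary.
HB.instance Definition _ : GRing.Zmodule homology := GRing.Zmodule.on homology.
HB.instance Definition _ :
    @ZmodQuotient cycles (Quotient.equiv is_boundary) 0 -%R +%R homology :=
  ZmodQuotient.on homology.

End Homology.

Section HomologyMap.
Variables (A B C A' B' C' : zmodType).
Variables (f : {additive A -> B}) (g : {additive B -> C}).
Variables (f' : {additive A' -> B'}) (g' : {additive B' -> C'}).
Variables (u : {additive A -> A'}) (v : {additive B -> B'})
          (w : {additive C -> C'}).
Hypotheses (uv : forall a, v (f a) = f' (u a))
           (vw : forall b, w (g b) = g' (v b)).

Lemma cycles_map_subproof (z : cycles g) : is_cycle g' (v (val z)).
Proof. by rewrite /is_cycle -vw (eqP (valP z)) raddf0. Qed.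

Definition cycles_map (z : cycles g) : cycles g' :=
  Sub (v (val z)) (cycles_map_subproof z).

Definition homology_map (x : homology f g) : homology f' g' :=
  \pi_(homology f' g') (cycles_map (repr x)).

Lemma homology_map_pi (z : cycles g) :
  homology_map (\pi_(homology f g) z) = \pi_(homology f' g') (cycles_map z).
Proof.
apply/eqP; rewrite -Quotient.idealrBE; apply/asboolP.
have : repr (\pi_(homology f g) z) - z \in is_boundary f (g:=g).
  by rewrite Quotient.idealrBE reprK.
move=> /asboolP[a fa]; exists (u a).
by rewrite -uv fa !raddfB.
Qed.

Lemma homology_map_is_zmod_morphism : zmod_morphism homology_map.
Proof.
move=> x y; rewrite -[x]reprK -[y]reprK -raddfB !homology_map_pi -raddfB.
by congr (\pi _); apply/val_inj; rewrite /= !raddfB.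
Qed.

End HomologyMap.

Section Cohomology.
Variables (K : groupType) (M : zmodType).

(* Inhomogeneous cochains with values in M, on which K acts trivially. *)
Definition coboundary1 (f : K -> M) : K -> K -> M :=
  fun x y => f y - f (x * y)%g + f x.

Definition coboundary2 (f : K -> K -> M) : K -> K -> K -> M :=
  fun x y z => f y z - f (x * y)%g z + f x (y * z)%g - f x y.

Lemma coboundary1_is_zmod_morphism : zmod_morphism coboundary1.
Proof.
move=> f g; apply/funext=> x; apply/funext=> y.
by rewrite /coboundary1 !fctE !opprD !opprK !addrA [LHS](ACl (1*3*5*2*4*6)).
Qed.
HB.instance Definition _ := GRing.isZmodMorphism.Build _ _ coboundary1
  coboundary1_is_zmod_morphism.

Lemma coboundary2_is_zmod_morphism : zmod_morphism coboundary2.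
Proof.
move=> f g; apply/funext=> x; apply/funext=> y; apply/funext=> z.
rewrite /coboundary2 !fctE !opprD !opprK !addrA.
by rewrite [LHS](ACl (1*3*5*7*2*4*6*8)).
Qed.
HB.instance Definition _ := GRing.isZmodMorphism.Build _ _ coboundary2
  coboundary2_is_zmod_morphism.

Lemma coboundary2K (f : K -> M) : coboundary2 (coboundary1 f) = 0.
Proof.
apply/funext=> x; apply/funext=> y; apply/funext=> z.
rewrite /coboundary2 /coboundary1 mulgA !opprD !opprK !addrA.
rewrite [LHS](ACl ((1*4)*(7*2)*(3*10)*(5*8)*(11*6)*(9*12))) /=.
by rewrite !subrr !addr0.
Qed.

Definition cohomology2 := homology coboundary1 coboundary2.

End Cohomology.

Section Subgroup.
Variables (K : groupType) (A : groupClosed K).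

Definition subgroup : Type := {x : K | x \in A}.
HB.instance Definition _ := SubChoice.on subgroup.

Lemma subgroup_group_closed : group_closed (fun x : K => x \in A).
Proof. by split=> [|x y]; [exact: gpred1 | exact: gpredF]. Qed.
HB.instance Definition _ := SubChoice_isSubGroup.Build K (fun x => x \in A)
  subgroup subgroup_group_closed.

Definition is_abelian : Prop := {in A &, commutative (@mul K)}.

End Subgroup.

Section Restriction.
Variables (K : groupType) (A : groupClosed K) (M : zmodType).

Definition restrict1 (f : K -> M) : subgroup A -> M := fun x => f (val x).
Definition restrict2 (f : K -> K -> M) : subgroup A -> subgroup A -> M :=
  fun x y => f (val x) (val y).
Definition restrict3 (f : K -> K -> K -> M) :
    subgroup A -> subgroup A -> subgroup A -> M :=
  fun x y z => f (val x) (val y) (val z).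

HB.instance Definition _ := GRing.isZmodMorphism.Build _ _ restrict1
  (fun f g => erefl).
HB.instance Definition _ := GRing.isZmodMorphism.Build _ _ restrict2
  (fun f g => erefl).
HB.instance Definition _ := GRing.isZmodMorphism.Build _ _ restrict3
  (fun f g => erefl).

Lemma restrict_coboundary1 (f : K -> M) :
  restrict2 (coboundary1 f) = coboundary1 (restrict1 f).
Proof. by []. Qed.

Lemma restrict_coboundary2 (f : K -> K -> M) :
  restrict3 (coboundary2 f) = coboundary2 (restrict2 f).
Proof. by []. Qed.

Definition restriction : cohomology2 K M -> cohomology2 (subgroup A) M :=
  homology_map (@coboundary1 (subgroup A) M) restrict_coboundary2.

HB.instance Definition _ := GRing.isZmodMorphism.Build _ _ restriction
  (homology_map_is_zmod_morphism restrict_coboundary1 restrict_coboundary2).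

End Restriction.

Definition integral : {pred rat} := fun q => q \is a Num.int.

Lemma integral_zmod_closed : zmod_closed integral.
Proof. by split=> [|x y]; [exact: rpred0 | exact: rpredB]. Qed.
HB.instance Definition _ :=
  GRing.isZmodClosed.Build rat integral integral_zmod_closed.

Definition Q_mod_Z : zmodType := Quotient.quot integral.

(* The intersection of the kernels of the restriction maps is the kernel of
   the map they induce to the direct sum when K is finite, and to the direct
   product in general. *)
Definition bogomolov_multiplier (K : groupType) : set (cohomology2 K Q_mod_Z) :=
  [set x | forall A : groupClosed K, is_abelian A ->
             restriction A x = 0]%classic.

Arguments bogomolov_multiplier K : clear implicits.

Section SchurMultiplier.
Variable G : finGroupType.

(* The degree n part of the (inhomogeneous) bar complex of G tensored with Z
   over Z[G] is the free abelian group on G^n, seen as {ffun G^n -> int}. *)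
Definition chain_basis (X : finType) (x : X) : {ffun X -> int} :=
  [ffun y => (y == x)%:Z].

Definition linear_ext (X : finType) (V : zmodType) (F : X -> V)
  (c : {ffun X -> int}) : V := \sum_x F x *~ c x.

Lemma linear_ext_is_zmod_morphism X V F : zmod_morphism (@linear_ext X V F).
Proof.
move=> c d; rewrite /linear_ext -sumrB; apply: eq_bigr => x _.
by rewrite !ffunE mulrzBr.
Qed.
HB.instance Definition _ X V F := GRing.isZmodMorphism.Build _ _
  (@linear_ext X V F) (@linear_ext_is_zmod_morphism X V F).

Definition boundary2 : {additive {ffun G * G -> int} -> {ffun G -> int}} :=
  linear_ext (fun p : G * G => let: (x, y) := p in
    chain_basis y - chain_basis (x * y)%g + chain_basis x).

Definition boundary3 :
    {additive {ffun G * G * G -> int} -> {ffun G * G -> int}} :=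
  linear_ext (fun p : G * G * G => let: (x, y, z) := p in
    chain_basis (y, z) - chain_basis (x * y, z)%g + chain_basis (x, y * z)%g
      - chain_basis (x, y)).

Lemma linear_ext_basis (X : finType) (V : zmodType) (F : X -> V) (x : X) :
  linear_ext F (chain_basis x) = F x.
Proof.
rewrite /linear_ext (bigD1 x) //= ffunE eqxx big1 ?addr0 // => y /negPf yx.
by rewrite ffunE yx.
Qed.

Lemma boundary2K (c : {ffun G * G * G -> int}) : boundary2 (boundary3 c) = 0.
Proof.
have -> : boundary3 c = \sum_p boundary3 (chain_basis p) *~ c p.
  by apply: eq_bigr => p _; rewrite /boundary3 /= linear_ext_basis.
rewrite raddf_sum big1 // => -[[x y] z] _; rewrite [in LHS]/= linear_ext_basis.
rewrite raddfMz !(raddfB, raddfD) /= !linear_ext_basis mulgA.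
rewrite !opprD !opprK !addrA.
rewrite [X in X *~ _](ACl ((1*4)*(7*2)*(3*10)*(5*8)*(11*6)*(9*12))) /=.
by rewrite !subrr !addr0 mul0rz.
Qed.

Definition schur_multiplier : zmodType := homology boundary3 boundary2.

End SchurMultiplier.

Definition zmod_isomorphic (U V : zmodType) : Prop :=
  exists f : {additive U -> V}, bijective f.

Section Presentation.
Variable X : choiceType.

(* (x, true) stands for the generator x, and (x, false) for its inverse. *)
Definition word : Type := seq (X * bool).
HB.instance Definition _ := Choice.on word.

Definition word_inv (w : word) : word := rev [seq (a.1, ~~ a.2) | a <- w].

Variable R : word -> word -> Prop.

Inductive word_eq : word -> word -> Prop :=
  | word_eq_refl w : word_eq w w
  | word_eq_sym w1 w2 : word_eq w1 w2 -> word_eq w2 w1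
  | word_eq_trans w1 w2 w3 : word_eq w1 w2 -> word_eq w2 w3 -> word_eq w1 w3
  | word_eq_cat w1 w2 w1' w2' :
      word_eq w1 w1' -> word_eq w2 w2' -> word_eq (w1 ++ w2) (w1' ++ w2')
  | word_eq_cancel x b : word_eq [:: (x, b); (x, ~~ b)] [::]
  | word_eq_rel w1 w2 : R w1 w2 -> word_eq w1 w2.

Definition word_eqb : rel word := fun w1 w2 => `[< word_eq w1 w2 >].

Lemma word_eqb_equiv : equiv_class_of word_eqb.
Proof.
split=> [w|w1 w2|w2 w1 w3]; first by apply/asboolP; apply: word_eq_refl.
  by apply/asboolP/asboolP; apply: word_eq_sym.
by move=> /asboolP w12 /asboolP w23; apply/asboolP; apply: word_eq_trans w23.
Qed.
Canonical word_eqb_equivRel := EquivRelPack word_eqb_equiv.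

(* The group generated by X, with a relation w1 = w2 whenever R w1 w2. *)
Definition presented : Type := {eq_quot word_eqb}.
HB.instance Definition _ := Choice.on presented.
HB.instance Definition _ := EqQuotient.on presented.

Definition presented_mul (u v : presented) : presented :=
  \pi_presented (repr u ++ repr v : word).
Definition presented_inv (u : presented) : presented :=
  \pi_presented (word_inv (repr u)).
Definition presented_one : presented := \pi_presented ([::] : word).

Lemma presented_eqP (w1 w2 : word) :
  \pi_presented w1 = \pi_presented w2 <-> word_eq w1 w2.
Proof.
split=> [/eqP|w12]; first by rewrite (@eqmodE word word_eqb) => /asboolP.
by apply/eqP; rewrite (@eqmodE word word_eqb); apply/asboolP.
Qed.

Lemma repr_pi (w : word) : word_eq (repr (\pi_presented w)) w.
Proof. by apply/presented_eqP; rewrite reprK. Qed.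

Lemma presented_mul_pi (w1 w2 : word) :
  presented_mul (\pi_presented w1) (\pi_presented w2) =
    \pi_presented (w1 ++ w2 : word).
Proof. by apply/presented_eqP; apply: word_eq_cat; apply: repr_pi. Qed.

Lemma word_eq_mulV (w : word) : word_eq (w ++ word_inv w) [::].
Proof.
elim: w => [|[x b] w IHw]; first exact: word_eq_refl.
have -> : ((x, b) :: w) ++ word_inv ((x, b) :: w) =
    [:: (x, b)] ++ (w ++ word_inv w) ++ [:: (x, ~~ b)].
  by rewrite /word_inv /= rev_cons -cats1 catA.
apply: word_eq_trans (word_eq_cancel x b).
apply: (@word_eq_cat [:: (x, b)] _ [:: (x, b)]); first exact: word_eq_refl.
by apply: (@word_eq_cat _ _ [::] _ IHw); apply: word_eq_refl.
Qed.

Lemma word_invK : involutive word_inv.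
Proof.
move=> w; rewrite /word_inv -map_rev revK -map_comp map_id_in // => -[x b] _.
by rewrite /= negbK.
Qed.

Lemma word_eq_mulV_l (w : word) : word_eq (word_inv w ++ w) [::].
Proof. by rewrite -{2}[w]word_invK; apply: word_eq_mulV. Qed.

Lemma presented_mulA : associative presented_mul.
Proof.
elim/quotW=> u; elim/quotW=> v; elim/quotW=> w.
rewrite (presented_mul_pi u v) (presented_mul_pi v w) !presented_mul_pi.
by rewrite catA.
Qed.

Lemma presented_mul1 : left_id presented_one presented_mul.
Proof. by move=> u; rewrite -[u]reprK presented_mul_pi. Qed.
Lemma presented_1mul : right_id presented_one presented_mul.
Proof. by move=> u; rewrite -[u]reprK presented_mul_pi cats0. Qed.
Lemma presented_mulV : left_inverse presented_one presented_inv presented_mul.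
Proof.
move=> u; rewrite -{2}[u]reprK presented_mul_pi; apply/presented_eqP.
exact: word_eq_mulV_l.
Qed.
Lemma presented_Vmul : right_inverse presented_one presented_inv presented_mul.
Proof.
move=> u; rewrite -{1}[u]reprK presented_mul_pi; apply/presented_eqP.
exact: word_eq_mulV.
Qed.

HB.instance Definition _ := isGroup.Build presented presented_mulA
  presented_mul1 presented_1mul presented_mulV presented_Vmul.

End Presentation.

(* These are left actions, unlike those of action.v. *)
Record left_action_by_aut (G H : groupType) (act : G -> H -> H) : Prop := {
  left_act1 : forall h, act 1%g h = h;
  left_actM : forall g g' h, act (g * g')%g h = act g (act g' h);
  left_act_morph : forall g, {morph act g : h h' / (h * h')%g}
}.

Section TensorProduct.
Variables G H : groupType.

Variables (actG : G -> H -> H) (actH : H -> G -> G).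

Record compatible_actions : Prop := {
  compatibleH : forall g h h',
    actG (actH h g) h' = (h * actG g (h^-1 * h' * h) * h^-1)%g;
  compatibleG : forall g g' h,
    actH (actG g h) g' = (g * actH h (g^-1 * g' * g) * g^-1)%g
}.

(* The generator g (x) h *)
Local Notation "g # h" := ((g, h), true) (at level 30).

Inductive tensor_rel :
    word (G * H)%type -> word (G * H)%type -> Prop :=
  | tensor_rel_l g g' h :
      tensor_rel [:: (g * g')%g # h]
                 [:: (g * g' * g^-1)%g # (actG g h); g # h]
  | tensor_rel_r g h h' :
      tensor_rel [:: g # (h * h')%g]
                 [:: g # h; (actH h g) # (h * h' * h^-1)%g].

Definition tensor : groupType := presented tensor_rel.

End TensorProduct.

(* Main.v *)
From HB Require Import structures.
From mathcomp Require Import all_boot all_order all_algebra.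
From mathcomp Require Import all_fingroup all_solvable.
From mathcomp Require Import boolp classical_sets functions.
From mathcomp Require Import generic_quotient ring_quotient.
Require Import Defs.

(**
Let K be the tensor product of G and H.

Reduction to commutators.  A class of H^2(K, Q/Z) is a central extension E of
K by Q/Z.  It vanishes on all abelian subgroups exactly when commuting
elements of K have commuting lifts in E; as [x, y] lies over [phi x, phi y],
this says that a commutator of E lying in the kernel of phi : E -> K is
trivial.  If moreover E' meets the kernel trivially, then Q/Z embeds into the
abelianization E/E', is a direct factor of it because it is divisible, and
the projection onto that factor splits E.  So K has trivial Bogomolov
multiplier as soon as, for every surjection phi : E -> K through which
commutators lift faithfully in this sense, E' meets the kernel of phi
trivially ([bogomolov_multiplier_trivial]).

Passing to G.  The map lambda sending g (x) h to g (h.g)^-1 is a homomorphism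
K -> G, its kernel is central because conjugation in K by k is the action of
lambda k, and its image D is normal in G.  Hence pi = lambda phi makes E a
central extension of D, and only the group D matters in the first two cases.

- If G is metacyclic, so is D.  The preimage in E of the cyclic normal
  subgroup of D is abelian, and with b lifting a generator of the quotient
  every element of E' is a single commutator [u, b]
  ([metacyclic_derived]).

- If G is symmetric, then D consists of even permutations, since
  automorphisms of S_n preserve parity; so D is trivial or A_n.  For n = 5 or
  n >= 8 a 3-cycle has a canonical lift Z a b c to E of order 3, compatible
  with conjugation and inversion; this is where n matters, through the
  perfectness of the pointwise stabilizer of three points in A_n.  All squares
  (Z a b c * Z d b c)^2 are equal to one central delta with delta^2 = 1, and
  the lifts satisfy the relations of A_n up to delta; hence E' meets the
  kernel of pi inside {1, delta}.  Finally delta comes from a commutator of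
  lifts of two commuting double transpositions, so it is trivial as soon as
  it lies in the kernel of phi ([alternating_derived]).

- If G is simple, D is trivial or G.  When G is nonabelian and D = G, the
  perfect group L = E' is a central extension of G whose kernel is a quotient
  of M(G), hence of order at most 2.  This makes automorphisms of G lift to L
  and fix the kernel of L -> G, so that g (x) h |-> l (h.l)^-1, for l in L
  over g, is a well-defined homomorphism Theta : K -> L.  On the perfect group
  L the composite of phi and Theta is the identity, because it is so modulo
  the centre; thus phi is injective on L ([perfect_tensor_derived]).
*)

Set Implicit Arguments.
Unset Strict Implicit.
Unset Printing Implicit Defensive.

Import GRing.Theory Num.Theory.

Notation "{ 'hom' G -> K }" := (UMagmaMorphism.type G K)
  (at level 0, G at level 98, K at level 99, format "{ 'hom'  G  ->  K }").

Local Open Scope group_scope.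

(** * Commutators and the derived subgroup *)

Lemma mul_morph1 (E F : groupType) (f : E -> F) :
  {morph f : x y / x * y} -> f 1 = 1.
Proof. by move=> fM; apply: (mulgI (f 1)); rewrite -fM !mulg1. Qed.

Lemma mul_morphV (E F : groupType) (f : E -> F) :
  {morph f : x y / x * y} -> {morph f : x / x^-1}.
Proof.
by move=> fM x; apply/esym/mulg1_eq; rewrite -fM mulgV mul_morph1.
Qed.

Section HomOfMorph.
Variables (E F : groupType) (f : E -> F).

Definition hom_fun (_ : {morph f : x y / x * y}) := f.
Variable fM : {morph f : x y / x * y}.

Lemma hom_fun_morphism : monoid.monoid_morphism (hom_fun fM).
Proof. by split=> //; apply: mul_morph1. Qed.
HB.instance Definition _ := isUMagmaMorphism.Build E F (hom_fun fM)
  hom_fun_morphism.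

Lemma hom_of_morph : exists g : {hom E -> F}, forall x, g x = f x.
Proof. by exists (hom_fun fM). Qed.

End HomOfMorph.

Definition central (E : groupType) (x : E) : Prop := forall y, commute x y.

(** The derived subgroup for [S = setT], and [derived (derived setT)] is the
    second derived subgroup.  The inverse of a commutator is a commutator, so
    right multiplications generate a subgroup. *)
Inductive derived (E : groupType) (S : E -> Prop) : E -> Prop :=
  | derived1 : derived S 1
  | derivedR x y z :
      derived S x -> S y -> S z -> derived S (x * [~ y, z]).

Section Derived.
Variable E : groupType.
Implicit Types (S : E -> Prop) (x y z : E).

Lemma derivedM S x y : derived S x -> derived S y -> derived S (x * y).
Proof.
move=> Sx; elim=> [|y' u v _ IH Su Sv]; first by rewrite mulg1.
by rewrite mulgA; apply: derivedR.
Qed.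

Lemma derived_comm S x y : S x -> S y -> derived S [~ x, y].
Proof. by move=> Sx Sy; rewrite -[X in derived _ X]mul1g; do !constructor. Qed.

Lemma derivedV S x : derived S x -> derived S x^-1.
Proof.
elim=> [|x' u v _ IH Su Sv]; first by rewrite invg1; constructor.
by rewrite invgM invgR; apply: derivedM IH; apply: derived_comm.
Qed.

Lemma derived_ind_mul (P : E -> Prop) S x :
  P 1 -> (forall y z, P y -> P z -> P (y * z)) ->
  (forall y z, S y -> S z -> P [~ y, z]) -> derived S x -> P x.
Proof. by move=> P1 PM PR; elim=> [|y u v _ Py Su Sv]; auto. Qed.

Lemma derivedJ x y : derived setT x -> derived setT (x ^ y).
Proof.
elim=> [|x' u v _ IH _ _]; first by rewrite conj1g; constructor.
by rewrite conjMg conjRg; constructor.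
Qed.

Lemma commg_centralM x y z t : central z -> central t ->
  [~ x * z, y * t] = [~ x, y].
Proof.
move=> cz ct.
have cR u v w : central w -> [~ u, v * w] = [~ u, v] :> E.
  by move=> cw; rewrite !commgEl conjgM (conjgE (u ^ v)) -(cw (u ^ v)) mulKg.
by rewrite cR // -invgR cR // invgR.
Qed.

Lemma centralM z t : central z -> central t -> central (z * t).
Proof. by move=> cz ct y; apply/commute_sym/commuteM; apply/commute_sym. Qed.

Lemma centralV z : central z -> central z^-1.
Proof. by move=> cz y; apply/commute_sym/commuteV/commute_sym. Qed.

End Derived.

Lemma derived_morph (E F : groupType) (f : {hom E -> F}) (S : E -> Prop)
    (S' : F -> Prop) x :
  (forall y, S y -> S' (f y)) -> derived S x -> derived S' (f x).
Proof.
move=> SS'; elim=> [|y u v _ IH Su Sv].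
  by rewrite gmulf1; exact: derived1.
by rewrite gmulfM gmulfR; apply: derivedR => //; apply: SS'.
Qed.

Section Abelianization.
Variable E : groupType.

Definition ab_eqb : rel E := fun x y => `[< derived setT (x^-1 * y) >].

Lemma ab_eqb_equiv : equiv_class_of ab_eqb.
Proof.
split=> [x|x y|y x z]; first by apply/asboolP; rewrite mulVg; constructor.
  by apply/asboolP/asboolP => /derivedV; rewrite invgM invgK.
move=> /asboolP xy /asboolP yz; apply/asboolP.
by have := derivedM xy yz; rewrite mulgA mulgK.
Qed.
Canonical ab_eqb_equivRel := EquivRelPack ab_eqb_equiv.

Local Open Scope quotient_scope.

Definition abelianization : Type := {eq_quot ab_eqb}.
HB.instance Definition _ := Choice.on abelianization.
HB.instance Definition _ := EqQuotient.on abelianization.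

Definition ab_pi (x : E) : abelianization := \pi_abelianization x.

Lemma ab_piP x y : ab_pi x = ab_pi y <-> derived setT (x^-1 * y).
Proof.
split=> [/eqP|xy]; first by rewrite (@eqmodE E ab_eqb) => /asboolP.
by apply/eqP; rewrite (@eqmodE E ab_eqb); apply/asboolP.
Qed.

Lemma ab_piS u : exists x, u = ab_pi x.
Proof. by exists (repr u); rewrite /ab_pi reprK. Qed.

Lemma ab_repr x : derived setT ((repr (ab_pi x))^-1 * x).
Proof. by apply/ab_piP; rewrite /ab_pi reprK. Qed.

Definition ab_add (u v : abelianization) := ab_pi (repr u * repr v).
Definition ab_opp (u : abelianization) := ab_pi (repr u)^-1.

Lemma ab_addE x y : ab_add (ab_pi x) (ab_pi y) = ab_pi (x * y).
Proof.
apply/ab_piP.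
have -> : forall a b : E, (a * b)^-1 * (x * y) = b^-1 * y * (a^-1 * x) ^ y.
  by move=> a b; rewrite conjgE invgM -!mulgA mulVKg.
by apply: derivedM; [|apply: derivedJ]; apply: ab_repr.
Qed.

Lemma ab_oppE x : ab_opp (ab_pi x) = ab_pi x^-1.
Proof.
apply/ab_piP; rewrite invgK.
have := derivedJ x^-1 (derivedV (ab_repr x)).
by rewrite conjgE !invgM !invgK !mulgA mulgV mul1g.
Qed.

Lemma ab_addA : associative ab_add.
Proof.
move=> u v w.
have [[x ->] [y ->] [z ->]] := And3 (ab_piS u) (ab_piS v) (ab_piS w).
by rewrite !ab_addE mulgA.
Qed.

Lemma ab_addC : commutative ab_add.
Proof.
move=> u v; have [[x ->] [y ->]] := conj (ab_piS u) (ab_piS v).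
rewrite !ab_addE; apply/ab_piP.
by rewrite invgM -!mulgA -conjgE; apply: derived_comm.
Qed.

Lemma ab_add0 : left_id (ab_pi 1) ab_add.
Proof. by move=> u; have [x ->] := ab_piS u; rewrite ab_addE mul1g. Qed.

Lemma ab_addN : left_inverse (ab_pi 1) ab_opp ab_add.
Proof. by move=> u; have [x ->] := ab_piS u; rewrite ab_oppE ab_addE mulVg. Qed.

HB.instance Definition _ := GRing.isZmodule.Build abelianization
  ab_addA ab_addC ab_add0 ab_addN.

Lemma ab_piM x y : ab_pi (x * y) = (ab_pi x + ab_pi y)%R.
Proof. by rewrite -ab_addE. Qed.

Lemma ab_piN x : ab_pi x^-1 = (- ab_pi x)%R.
Proof. by rewrite -ab_oppE. Qed.

Lemma ab_pi_eq0 x : ab_pi x = 0%R <-> derived setT x.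
Proof.
split=> [/ab_piP|Dx]; first by rewrite mulg1 => /derivedV; rewrite invgK.
by apply/ab_piP; rewrite mulg1; apply: derivedV.
Qed.

End Abelianization.

(** * Divisible groups are injective *)

Section Injective.
Local Open Scope ring_scope.
Local Open Scope classical_set_scope.

Definition divisible (M : zmodType) : Prop :=
  forall (a : M) (n : nat), (0 < n)%N -> exists b, b *+ n = a.

Variables (V M : zmodType).

(** A homomorphism to [M] from a subgroup of [V], as a graph; graphs of partial
    homomorphisms are ordered by inclusion, which is what Zorn's lemma needs. *)
Definition partial_hom (R : set (V * M)) : Prop :=
  [/\ R (0, 0), forall p q, R p -> R q -> R (p - q)
    & forall a, R (0, a) -> a = 0].

(** A value at [x] must be compatible with the values already taken on the
    multiples of [x]; these multiples are generated by one of them, say [d]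
    times [x], so it suffices to divide the value there by [d]. *)
Lemma partial_hom_extend1 (R : set (V * M)) (x : V) :
  divisible M -> partial_hom R ->
  exists2 R', partial_hom R' & R `<=` R' /\ exists a, R' (x, a).
Proof.
move=> divM [R0 RB Rf].
have RN p : R p -> R (- p) by move=> Rp; rewrite -sub0r; apply: RB.
have RD p q : R p -> R q -> R (p + q).
  by move=> Rp /RN; rewrite -{2}[q]opprK; apply: RB.
have RMn p n : R p -> R (p *+ n).
  by move=> Rp; elim: n => [|n IH]; rewrite ?mulr0n // mulrS; apply: RD.
have RMz p (n : int) : R p -> R (p *~ n).
  by move=> Rp; case: n => n; [apply: RMn | apply/RN/RMn].
have fstMz (p : V * M) (n : int) : p *~ n = (p.1 *~ n, p.2 *~ n).
  have E k : p *+ k = (p.1 *+ k, p.2 *+ k).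
    by elim: k => [|k IH]; rewrite ?mulr0n // !mulrS IH; case: p {IH}.
  by case: n => n; rewrite /intmul E.
have [b bP] : exists b, forall (n : int) a, R (x *~ n, a) -> a = b *~ n.
  pose D := [pred d : nat | `[< (0 < d)%N /\ exists a, R (x *+ d, a) >]].
  have pos_part (n : int) a : R (x *~ n, a) -> n != 0 ->
      (0 < `|n|)%N /\ exists a', R (x *+ `|n|%N, a').
    move=> Rna n0; split; first by rewrite absz_gt0.
    case: n Rna n0 => n Rna n0; first by exists a.
    exists (- a); have := RN _ Rna; congr R.
    by apply/injective_projections; rewrite //= opprK.
  (* Without a nonzero multiple of x in the domain, any value will do. *)
  case: (pselect (exists d, D d)) => [exD|noD]; last first.
    exists 0 => n a Rna; case: (eqVneq n 0) => [n0|n0].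
      by move: Rna; rewrite n0 mulr0z => /Rf ->.
    by case: noD; exists `|n|%N; apply/asboolP; apply: pos_part Rna n0.
  case: (ex_minnP exD) => d /asboolP[d0 [c Rdc]] dmin.
  have [b bd] := divM c d d0; exists b => n a Rna.
  have dn0 : d%:Z != 0 by case: (d) d0.
  pose q := (n %/ d)%Z; pose r := (n %% d)%Z.
  have nE : n = q * d%:Z + r by apply: divz_eq.
  have r0 : 0 <= r by apply: modz_ge0.
  have rd : r < d%:Z by rewrite /r ltz_mod.
  have xd : x *+ d = x *~ d%:Z by [].
  have Rr : R (x *~ r, a - c *~ q).
    have := RB _ _ Rna (RMz _ q Rdc); rewrite fstMz /=; congr R.
    apply/injective_projections => //=.
    by rewrite xd -mulrzA (mulrC d%:Z) -mulrzBr nE addrC addKr.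
  have r_eq0 : r = 0.
    apply/eqP/negPn/negP => rn0.
    have /dmin : D `|r|%N by apply/asboolP; apply: pos_part Rr rn0.
    by rewrite leqNgt -ltz_nat gez0_abs ?rd.
  move: Rr; rewrite r_eq0 mulr0z => /Rf/eqP; rewrite subr_eq0 => /eqP ->.
  by rewrite -bd nE r_eq0 addr0 (mulrC q) mulrzA.
exists [set p | exists n : int, R (p.1 - x *~ n, p.2 - b *~ n)].
  split=> [|[v a] [w c] [n Rn] [m Rm]|a [n]] /=.
  - by exists 0; rewrite !mulr0z !subr0.
  - exists (n - m); move: (RB _ _ Rn Rm); congr R.
    by apply/injective_projections; rewrite /= mulrzBr !opprD !opprK addrACA.
  - rewrite sub0r -mulrNz => /bP; rewrite mulrNz => /eqP.
    by rewrite -subr_eq0 opprK subrK => /eqP.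
split=> [p Rp|]; first by exists 0; rewrite !mulr0z !subr0; case: p Rp.
by exists b, 1; rewrite !mulr1z !subrr.
Qed.

(** By Zorn's lemma there is a maximal partial homomorphism containing [R];
    [partial_hom_extend1] shows that it is total. *)
Lemma divisible_injective (R : set (V * M)) :
  divisible M -> partial_hom R ->
  exists f : V -> M, {morph f : u v / u + v} /\ forall v a, R (v, a) -> f v = a.
Proof.
move=> divM pR.
have [S [pS maxS]] : exists S, partial_hom (R `|` S) /\
    forall S', S `<` S' -> ~ partial_hom (R `|` S').
  apply: (@Zorn_bigcup _ [set S | partial_hom (R `|` S)]) => F PF totF.
  have [R0 _ Rf] := pR.
  (* R is added to the members of the chain F since F may be empty. *)
  have common p q : (R `|` \bigcup_(X in F) X) p ->
     (R `|` \bigcup_(X in F) X) q -> (R p /\ R q) \/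
     exists X, [/\ F X, (R `|` X) p & (R `|` X) q].
    move=> [Rp|[X FX Xp]] [Rq|[Y FY Yq]]; first by left.
    - by right; exists Y; split=> //; [left|right].
    - by right; exists X; split=> //; [right|left].
    - case: (totF X Y FX FY) => XY.
        by right; exists Y; split=> //; right; auto.
      by right; exists X; split=> //; right; auto.
  split=> [|p q Up Uq|a]; first by left.
    case: (common p q Up Uq) => [[Rp Rq]|[X [FX Xp Xq]]].
      by left; case: pR => _ + _; apply.
    have [_ XB _] := PF _ FX.
    by case: (XB _ _ Xp Xq) => ?; [left | right; exists X].
  move=> [/Rf//|[X FX X0a]]; have [_ _ Xf] := PF _ FX.
  by apply: Xf; right.
have tot v : exists a, (R `|` S) (v, a).
  have [R' pR' [SR' [a R'a]]] := partial_hom_extend1 v divM pS.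
  case: (pselect ((R `|` S) (v, a))) => [|nS]; first by exists a.
  case: (maxS R').
    split; last by move=> R'S; apply: nS; right; apply: R'S.
    by move=> p Sp; apply: SR'; right.
  suff -> : R `|` R' = R' by [].
  by apply/seteqP; split=> [p [Rp|//]|p]; [apply: SR'; left | right].
have [f fP] := choice tot; exists f.
have [R0 RB Rf] := pS.
have fE v a : (R `|` S) (v, a) -> f v = a.
  move=> Sva; have := RB _ _ (fP v) Sva.
  rewrite [X in (R `|` S) X](_ : _ = (0, f v - a)); last first.
    by apply/injective_projections; rewrite /= ?subrr.
  by move=> /Rf/eqP; rewrite subr_eq0 => /eqP.
split=> [u v|v a Rva]; last by apply: fE; left.
apply: fE; have := RB _ _ (fP u) (RB _ _ R0 (fP v)); congr (_ _).
by apply/injective_projections; rewrite /= sub0r opprK.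
Qed.

End Injective.

Section QmodZ.
Local Open Scope ring_scope.
Local Open Scope quotient_scope.

Lemma Q_mod_Z_divisible : divisible Q_mod_Z.
Proof.
move=> a n n0; rewrite -[a]reprK; set q := repr a.
exists (\pi_Q_mod_Z (q / n%:R)); rewrite -raddfMn /=.
by rewrite -(mulr_natr (q / n%:R)) divfK // pnatr_eq0 -lt0n.
Qed.
End QmodZ.

(** * The Bogomolov multiplier in terms of commutators *)

Section Extension.
Variables (K : groupType) (M : zmodType) (f : K -> K -> M).
Hypothesis f_cocycle : (coboundary2 f = 0)%R.

Lemma cocycleE x y z : (f (x * y)%g z + f x y = f y z + f x (y * z)%g)%R.
Proof.
have := congr1 (fun h => h x y z) f_cocycle; rewrite /coboundary2 /= => /eqP.
rewrite -[X in _ == X]/(0%R : M) subr_eq0 addrAC subr_eq => /eqP ->.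
by rewrite addrC.
Qed.

Lemma cocycle1x x : f 1 x = f 1 1.
Proof. by have := cocycleE 1 1 x; rewrite !mul1g => /addrI ->. Qed.

Lemma cocyclex1 x : f x 1 = f 1 1.
Proof. by have := cocycleE x 1 1; rewrite !mulg1 addrC => /addIr ->. Qed.

(** The cocycle is an argument because the group law depends on it. *)
Definition extension_of (_ : coboundary2 f = 0%R) : Type := (K * M)%type.
Local Notation extension := (extension_of f_cocycle).
HB.instance Definition _ := Choice.on extension.

Definition ext_mul (u v : extension) : extension :=
  (u.1 * v.1, (u.2 + v.2 + f u.1 v.1)%R).
(* A cocycle need not vanish at (1, 1), which shifts the unit. *)
Definition ext_one : extension := (1, (- f 1 1)%R).
Definition ext_inv (u : extension) : extension :=
  (u.1^-1, (- u.2 - f u.1^-1 u.1 - f 1 1)%R).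

Lemma ext_mulA : associative ext_mul.
Proof.
move=> u v w; apply/injective_projections; rewrite /= ?mulgA //.
rewrite -!addrA; congr (_ + (_ + _))%R.
rewrite [(f u.1 v.1 + _)%R]addrCA; congr (_ + _)%R.
by rewrite [RHS]addrC cocycleE.
Qed.

Lemma ext_mul1 : left_id ext_one ext_mul.
Proof.
move=> [x a]; apply/injective_projections; rewrite /= ?mul1g //.
by rewrite cocycle1x addrAC addNr add0r.
Qed.

Lemma ext_1mul : right_id ext_one ext_mul.
Proof.
move=> [x a]; apply/injective_projections; rewrite /= ?mulg1 //.
by rewrite cocyclex1 addrNK.
Qed.

Lemma ext_mulV : left_inverse ext_one ext_inv ext_mul.
Proof.
move=> [x a]; apply/injective_projections; rewrite /= ?mulVg //.
by rewrite [LHS](ACl ((1*4)*(2*5)*3)) /= !addNr !add0r.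
Qed.

Lemma ext_Vmul : right_inverse ext_one ext_inv ext_mul.
Proof.
move=> [x a]; apply/injective_projections; rewrite /= ?mulgV //.
have := cocycleE x x^-1 x; rewrite mulgV mulVg cocycle1x cocyclex1.
rewrite addrC => /addIr ->.
by rewrite !addrA subrr sub0r addrAC addNr add0r.
Qed.

HB.instance Definition _ := isGroup.Build extension ext_mulA
  ext_mul1 ext_1mul ext_mulV ext_Vmul.

Definition ext_proj (u : extension) : K := u.1.

Lemma ext_proj_morphism : monoid.monoid_morphism ext_proj.
Proof. by []. Qed.
HB.instance Definition _ := isUMagmaMorphism.Build extension K ext_proj
  ext_proj_morphism.

End Extension.

(** Since [phi] maps [[~ x, y]] to the commutator of the images, this says that
    elements commute as soon as their images do. *)
Definition commutativity_preserving (E K : groupType) (phi : E -> K) : Prop :=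
  forall x y, phi [~ x, y] = 1 -> [~ x, y] = 1.

Section DoubleCentralizer.
Variables (K : groupType) (x y : K).

(** An abelian subgroup containing [x] and [y] when they commute, which
    avoids describing the elements of the subgroup that they generate. *)
Definition double_centralizer : {pred K} := fun z =>
  `[< forall t, commute t x -> commute t y -> commute t z >].

Lemma double_centralizer_closed : group_closed double_centralizer.
Proof.
split=> [|z t /asboolP Dz /asboolP Dt]; apply/asboolP => u ux uy.
  exact: commute1.
by apply: commuteM; [apply: Dz | apply/commuteV/Dt].
Qed.
HB.instance Definition _ := monoid.isMulClosed.Build K double_centralizer
  (group_closedM double_centralizer_closed).
HB.instance Definition _ := monoid.isMul1Closed.Build K double_centralizer
  double_centralizer_closed.1.
HB.instance Definition _ := isInvClosed.Build K double_centralizer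
  (group_closedV double_centralizer_closed).

Lemma double_centralizer_abelian :
  commute x y -> is_abelian double_centralizer.
Proof.
move=> xy u v /asboolP Du /asboolP Dv; apply: Dv.
  by apply/commute_sym/Du => //; apply: commute_sym.
by apply/commute_sym/Du => //; apply: commute_sym.
Qed.
End DoubleCentralizer.

Section Criterion.
Local Open Scope ring_scope.
Local Open Scope quotient_scope.

(** The extension [E] defined by a cocycle representing a class of the
    Bogomolov multiplier preserves commutativity.  If its derived subgroup meets
    the copy of [Q/Z] trivially, that copy embeds into the abelianization, where
    divisibility provides a retraction [r]; then [k |-> r (k, 0)] is a cochain
    whose coboundary is the cocycle. *)
Lemma bogomolov_multiplier_trivial (K : groupType) :
  (forall (E : groupType) (phi : {hom E -> K}),
     (forall k, exists x, phi x = k) -> commutativity_preserving phi ->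
     forall x, derived setT x -> phi x = 1%g -> x = 1%g) ->
  bogomolov_multiplier K = [set 0]%classic.
Proof.
move=> triv; apply/seteqP; split=> [c Bc|_ -> A _]; last by rewrite raddf0.
rewrite /= -[c]reprK; set z := repr c; pose f : K -> K -> Q_mod_Z := val z.
have f_cocycle : coboundary2 f = 0 by apply/eqP/(valP z).
have fC x y : commute x y -> f x y = f y x.
  move=> xy; pose A : groupClosed K := double_centralizer x y.
  have := Bc A (double_centralizer_abelian xy).
  rewrite -[c]reprK -/z /restriction.
  rewrite (homology_map_pi (@restrict_coboundary1 _ A Q_mod_Z)) => /eqP.
  rewrite -(raddf0 \pi_(cohomology2 (subgroup A) Q_mod_Z)).
  rewrite -Quotient.idealrBE subr0 => /asboolP[h hf].
  have Ax : x \in A by apply/asboolP.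
  have Ay : y \in A by apply/asboolP.
  pose el u (Au : u \in A) : subgroup A := exist _ u Au.
  have E u v (Au : u \in A) (Av : v \in A) :
      f u v = h (el v Av) - h (el u Au * el v Av)%g + h (el u Au).
    by have := congr1 (fun F => F (el u Au) (el v Av)) hf.
  rewrite (E _ _ Ax Ay) (E _ _ Ay Ax) addrAC [RHS]addrAC.
  congr (_ - h _); first exact: addrC.
  by apply/val_inj; rewrite /= xy.
have CP : commutativity_preserving
    (@ext_proj _ _ f f_cocycle : extension_of f_cocycle -> K).
  move=> u v; rewrite gmulfR => /eqP/commgP uv; apply/eqP/commgP.
  apply/injective_projections; rewrite /= ?uv //.
  by rewrite (addrC u.2) (fC _ _ uv).
have surj k : exists u : extension_of f_cocycle, ext_proj u = k.
  by exists (k, 0).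
(* The embedding of Q/Z, corrected by the shift of the unit of E. *)
pose iota (a : Q_mod_Z) : extension_of f_cocycle := (1%g, a - f 1%g 1%g).
pose R : set (abelianization (extension_of f_cocycle) * Q_mod_Z) :=
  [set p | p.1 = ab_pi (iota p.2)]%classic.
have iotaB a b : iota (a - b) = (iota a * (iota b)^-1)%g.
  apply/injective_projections; rewrite /= ?invg1 ?mulg1 //.
  rewrite !opprD !opprK !addrA [RHS](ACl (1*3*2*(4*5)*(6*7))) /=.
  by rewrite subrr addNr !addr0.
have R_hom : partial_hom R.
  split=> [|[u a] [v b] Ru Rv|a] /=.
  - by rewrite /R /= /iota sub0r.
  - rewrite [u](Ru : _ = _) [v](Rv : _ = _).
    by rewrite /R /= iotaB ab_piM ab_piN.
  move=> /esym/ab_pi_eq0 Da.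
  have /(congr1 snd) := triv _ _ surj CP _ Da erefl.
  by rewrite /= -[X in _ = X -> _]add0r => /addIr.
have [r [rD rR]] := divisible_injective Q_mod_Z_divisible R_hom.
apply/eqP; rewrite -(raddf0 \pi_(cohomology2 K Q_mod_Z)).
rewrite -Quotient.idealrBE subr0; apply/asboolP.
pose sec k : extension_of f_cocycle := (k, 0).
exists (fun k => r (ab_pi (sec k))).
apply/funext => x; apply/funext => y.
change (r (ab_pi (sec y)) - r (ab_pi (sec (x * y)%g)) + r (ab_pi (sec x))
  = f x y).
have secM : (sec x * sec y = sec (x * y) * iota (f x y))%g.
  apply/injective_projections; rewrite /= ?mulg1 // !add0r.
  by rewrite cocyclex1 // subrK.
have fE : r (ab_pi (iota (f x y))) = f x y by exact: rR.
have := congr1 (fun u => r (ab_pi u)) secM.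
rewrite !ab_piM !rD fE addrAC [r (ab_pi (sec y)) + _]addrC => ->.
by rewrite addrAC subrr add0r.
Qed.
End Criterion.

(** * The non-abelian tensor product over G *)

Section PresentedMorphism.
Variables (X : choiceType) (R : word X -> word X -> Prop) (L : groupType).
Variable F : X -> L.
Local Open Scope quotient_scope.

Definition presented_gen (x : X) : presented R :=
  \pi_(presented R) ([:: (x, true)] : word X).

Lemma presented_ind (P : presented R -> Prop) :
  P 1 -> (forall x u, P u -> P (presented_gen x * u)) ->
  (forall x u, P u -> P ((presented_gen x)^-1 * u)) -> forall u, P u.
Proof.
move=> P1 Pg PV; elim/quotW; elim=> [//|[x b] w IHw].
have -> : \pi_(presented R) ((x, b) :: w : word X) =
    \pi_(presented R) ([:: (x, b)] : word X) * \pi_(presented R) w.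
  by rewrite [RHS]presented_mul_pi.
case: b; first exact: Pg.
suff -> : \pi_(presented R) ([:: (x, false)] : word X) = (presented_gen x)^-1.
  exact: PV.
apply/esym/mulg1_eq; rewrite [LHS]presented_mul_pi; apply/presented_eqP.
exact: word_eq_cancel.
Qed.

Definition word_eval (w : word X) : L :=
  \prod_(a <- w) (if a.2 then F a.1 else (F a.1)^-1).

Hypothesis FR : forall w1 w2, R w1 w2 -> word_eval w1 = word_eval w2.

Lemma word_eval_eq w1 w2 : word_eq R w1 w2 -> word_eval w1 = word_eval w2.
Proof.
elim=> {w1 w2}
  [//|u v _ -> //|u v w _ -> _ -> //|u v u' v' _ IHu _ IHv|x b|u v /FR //].
  by rewrite /word_eval !big_cat /= -!/(word_eval _) IHu IHv.
rewrite /word_eval !big_cons !big_nil mulg1 /=.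
by case: b; rewrite ?mulgV ?mulVg.
Qed.

Lemma presented_hom :
  exists f : {hom presented R -> L}, forall x, f (presented_gen x) = F x.
Proof.
pose lift (u : presented R) := word_eval (repr u).
have liftM : {morph lift : u v / u * v}.
  move=> u v; rewrite /lift (word_eval_eq (repr_pi _ _)).
  by rewrite /word_eval big_cat.
have [f fE] := hom_of_morph liftM; exists f => x.
rewrite fE /lift (word_eval_eq (repr_pi _ _)).
by rewrite /word_eval big_cons big_nil mulg1.
Qed.

End PresentedMorphism.

Section LeftAction.
Variables (G H : groupType) (act : G -> H -> H).
Hypothesis actP : left_action_by_aut act.

Lemma actM g h h' : act g (h * h') = act g h * act g h'.
Proof. exact: left_act_morph actP g h h'. Qed.

Lemma act1 g : act g 1 = 1.
Proof. exact: mul_morph1 (left_act_morph actP g). Qed.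

Lemma actV g h : act g h^-1 = (act g h)^-1.
Proof. exact: mul_morphV (left_act_morph actP g) h. Qed.

Lemma actK g : cancel (act g) (act g^-1).
Proof. by move=> h; rewrite -(left_actM actP) mulVg (left_act1 actP). Qed.

Lemma actKV g : cancel (act g^-1) (act g).
Proof. by move=> h; rewrite -(left_actM actP) mulgV (left_act1 actP). Qed.

End LeftAction.

Section Tensor.
Variables (G H : groupType) (actG : G -> H -> H) (actH : H -> G -> G).
Hypotheses (actGP : left_action_by_aut actG) (actHP : left_action_by_aut actH).
Hypothesis compat : compatible_actions actG actH.

Local Notation K := (tensor actG actH).

Definition tens (g : G) (h : H) : K := presented_gen _ (g, h).

Lemma tensor_ind (P : K -> Prop) :
  P 1 -> (forall g h u, P u -> P (tens g h * u)) ->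
  (forall g h u, P u -> P ((tens g h)^-1 * u)) -> forall u, P u.
Proof.
by move=> P1 Pg PV; apply: presented_ind => // -[g h]; [apply: Pg | apply: PV].
Qed.

Lemma tensL g g' h :
  tens (g * g') h = tens (g * g' * g^-1) (actG g h) * tens g h.
Proof.
rewrite [RHS]presented_mul_pi; apply/presented_eqP.
exact/word_eq_rel/tensor_rel_l.
Qed.

Lemma tensR g h h' :
  tens g (h * h') = tens g h * tens (actH h g) (h * h' * h^-1).
Proof.
rewrite [RHS]presented_mul_pi; apply/presented_eqP.
exact/word_eq_rel/tensor_rel_r.
Qed.

Lemma tensor_hom (L : groupType) (F : G -> H -> L) :
  (forall g g' h, F (g * g') h = F (g * g' * g^-1) (actG g h) * F g h) ->
  (forall g h h', F g (h * h') = F g h * F (actH h g) (h * h' * h^-1)) ->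
  exists f : {hom K -> L}, forall g h, f (tens g h) = F g h.
Proof.
move=> FL FR.
case: (@presented_hom _ (tensor_rel actG actH) L (fun p => F p.1 p.2)).
  move=> w1 w2 [g g' h|g h h'];
    by rewrite /word_eval !big_cons !big_nil !mulg1 /=.
by move=> f fE; exists f => g h; apply: fE.
Qed.

Lemma compatH g h h' : actG (actH h g) (h * h' * h^-1) = h * actG g h' * h^-1.
Proof. by rewrite (compatibleH compat) !mulgA mulVg mul1g mulgVK. Qed.

Lemma compatG g g' h : actH (actG g h) (g * g' * g^-1) = g * actH h g' * g^-1.
Proof. by rewrite (compatibleG compat) !mulgA mulVg mul1g mulgVK. Qed.

Lemma tensor_lambda :
  exists f : {hom K -> G}, forall g h, f (tens g h) = g * (actH h g)^-1.
Proof.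
apply: tensor_hom => [g g' h|g h h'].
  rewrite compatG (actM actHP) !invgM invgK !mulgA.
  by rewrite !mulgVK.
by rewrite -(left_actM actHP) mulgVK (left_actM actHP) mulgA mulgVK.
Qed.

Variable lambda : {hom K -> G}.
Hypothesis lambdaE : forall g h, lambda (tens g h) = g * (actH h g)^-1.

(** The two ways of expanding [tens (g * g') (h * h')] by the defining
    relations start with the same factor and end with the same factor. *)
Lemma tens_commute g g' h h' :
  tens (g * actH h g' * g^-1) (actG g (h * h' * h^-1)) * tens g h
  = tens g h * tens (actH h (g * g' * g^-1)) (h * actG g h' * h^-1).
Proof.
have E1 : tens (g * g') (h * h') =
  tens (g * g' * g^-1) (actG g h)
    * (tens (g * actH h g' * g^-1) (actG g (h * h' * h^-1)) * tens g h)
    * tens (actH h g) (h * h' * h^-1).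
  rewrite tensL (tensR g) (actM actGP) tensR compatG -!mulgA.
  congr (_ * (tens _ _ * _)).
  by rewrite !(actM actGP) (actV actGP).
have E2 : tens (g * g') (h * h') =
  tens (g * g' * g^-1) (actG g h)
    * (tens g h * tens (actH h (g * g' * g^-1)) (h * actG g h' * h^-1))
    * tens (actH h g) (h * h' * h^-1).
  rewrite tensR tensL (actM actHP) (tensL (actH h g)) compatH -!mulgA.
  congr (_ * (_ * (tens _ _ * _))).
  by rewrite !(actM actHP) (actV actHP).
by move: E2; rewrite E1 => /mulIg/mulgI.
Qed.

(** The content of [tens_commute]: conjugation by a generator is the action of
    its image in [G], which acts on both components of a generator. *)
Lemma tensor_conj k g h :
  k * tens g h * k^-1 = tens (lambda k * g * (lambda k)^-1) (actG (lambda k) h).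
Proof.
have gen g1 h1 g2 h2 : tens g1 h1 * tens g2 h2 * (tens g1 h1)^-1 =
    tens (lambda (tens g1 h1) * g2 * (lambda (tens g1 h1))^-1)
      (actG (lambda (tens g1 h1)) h2).
  rewrite lambdaE.
  pose h' := actG g1^-1 (h1^-1 * h2 * h1).
  pose g' := g1^-1 * actH h1^-1 g2 * g1.
  have := tens_commute g1 g' h1 h'.
  have -> : actH h1 (g1 * g' * g1^-1) = g2.
    by rewrite /g' !mulgA mulgV mul1g mulgK (actKV actHP).
  have -> : h1 * actG g1 h' * h1^-1 = h2.
    by rewrite /h' (actKV actGP) !mulgA mulgV mul1g mulgK.
  move=> <-; rewrite mulgK; congr (tens _ _).
    rewrite /g' !(actM actHP) (actV actHP) (actKV actHP).
    by rewrite invgM invgK !mulgA.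
  by rewrite (left_actM actGP) -(actV actHP) (compatibleH compat).
have genV g1 h1 g2 h2 : (tens g1 h1)^-1 * tens g2 h2 * tens g1 h1 =
    tens ((lambda (tens g1 h1))^-1 * g2 * lambda (tens g1 h1))
      (actG (lambda (tens g1 h1))^-1 h2).
  set x := lambda _.
  have := gen g1 h1 (x^-1 * g2 * x) (actG x^-1 h2).
  rewrite -/x (actKV actGP) !mulgA mulgV mul1g mulgK => <-.
  by rewrite !mulgA mulVg mul1g mulgVK.
elim/tensor_ind: k g h => [|g1 h1 u IH|g1 h1 u IH] g h.
- by rewrite gmulf1 !invg1 !mul1g !mulg1 (left_act1 actGP).
- have -> : tens g1 h1 * u * tens g h * (tens g1 h1 * u)^-1 =
      tens g1 h1 * (u * tens g h * u^-1) * (tens g1 h1)^-1.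
    by rewrite invgM !mulgA.
  by rewrite IH gen gmulfM (left_actM actGP) invgM !mulgA.
- have -> : (tens g1 h1)^-1 * u * tens g h * ((tens g1 h1)^-1 * u)^-1 =
      (tens g1 h1)^-1 * (u * tens g h * u^-1) * tens g1 h1.
    by rewrite invgM invgK !mulgA.
  by rewrite IH genV gmulfM gmulfV (left_actM actGP) invgM invgK !mulgA.
Qed.

Lemma tensor_lambda_central z : lambda z = 1 -> central z.
Proof.
move=> z1.
have zt g h : commute z (tens g h).
  have := tensor_conj z g h.
  rewrite z1 invg1 mul1g mulg1 (left_act1 actGP) /commute => {2}<-.
  by rewrite mulgVK.
elim/tensor_ind => [|g h u IH|g h u IH]; first exact: commute1.
  exact: commuteM.
by apply: commuteM => //; apply: commuteV.
Qed.

Lemma tensor_lambda_normal x k : exists k', lambda k' = x * lambda k * x^-1.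
Proof.
have gen g h : lambda (tens (x * g * x^-1) (actG x h)) =
    x * lambda (tens g h) * x^-1.
  by rewrite !lambdaE compatG !invgM invgK !mulgA mulgVK.
elim/tensor_ind: k => [|g h u [k' k'E]|g h u [k' k'E]].
- by exists 1; rewrite !gmulf1 mulg1 mulgV.
- exists (tens (x * g * x^-1) (actG x h) * k').
  by rewrite !gmulfM gen k'E !mulgA mulgVK.
- exists ((tens (x * g * x^-1) (actG x h))^-1 * k').
  by rewrite !(gmulfM, gmulfV) gen k'E !invgM invgK !mulgA mulgVK.
Qed.

End Tensor.

(** * Central extensions of metacyclic groups *)

Section Metacyclic.
Variables (E K : groupType) (G : finGroupType).
Variables (phi : {hom E -> K}) (pi : {hom E -> G}).
Hypothesis phiCP : commutativity_preserving phi.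
Hypothesis pi_central : forall z, pi z = 1 -> central z.

Lemma fiber_central x y : pi x = pi y -> exists2 z, central z & x = y * z.
Proof.
move=> xy; exists (y^-1 * x); last by rewrite mulVKg.
by apply: pi_central; rewrite gmulfM gmulfV xy mulVg.
Qed.

(** The preimage [At] of the normal cyclic subgroup is abelian, being a central
    extension of a cyclic group, and every element of [E] is a power of [b']
    times an element of [At].  So all commutators are products of elements
    [[~ u, b']] with [u] in [At], and these form a subgroup [W]. *)
Lemma metacyclic_derived (D : {group G}) :
  (forall x, pi x \in D) -> (forall d, d \in D -> exists x, pi x = d) ->
  metacyclic D -> forall x, derived setT x -> phi x = 1 -> x = 1.
Proof.
move=> piD Dpi /metacyclicP[A [/cyclicP[a Aa] nsAD /cyclicP[B DB]]].
have [[sAD nAD] Aa'] := (andP nsAD, (fintype.subsetP (normal_sub nsAD))).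
have [a' a'E] : exists x, pi x = a by apply/Dpi/Aa'; rewrite Aa cycle_id.
have [b bD bB] : exists2 b, b \in D & coset A b = B.
  have : B \in D / A by rewrite DB cycle_id.
  by case/morphimP=> b _ bD ->; exists b.
have [b' b'E] := Dpi b bD.
pose At u := pi u \in A.
have AtM u v : At u -> At v -> At (u * v) by rewrite /At gmulfM; apply: groupM.
have AtV u : At u -> At u^-1 by rewrite /At gmulfV groupV.
have AtJ u y : At u -> At (u ^ y).
  rewrite /At gmulfJ => uA; rewrite memJ_norm //.
  by apply: (fintype.subsetP nAD); apply: piD.
have AtX u : At u -> exists i z, central z /\ u = a' ^+ i * z.
  rewrite /At Aa => /cycleP[i ui]; exists i.
  have [|z cz uE] := @fiber_central u (a' ^+ i); last by exists z.
  by rewrite gmulfXn a'E.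
have AtC u v : At u -> At v -> commute u v.
  move=> /AtX[i [z [cz ->]]] /AtX[j [t [ct ->]]]; apply: commuteM.
    by apply/commute_sym/commuteM; [apply: commuteX2 | apply/commute_sym].
  exact/commute_sym.
have dec e : exists j u, At u /\ e = b' ^+ j * u.
  have : coset A (pi e) \in D / A by apply: mem_quotient; apply: piD.
  rewrite DB => /cycleP[j ej]; exists j, ((b' ^+ j)^-1 * e).
  split; last by rewrite mulVKg.
  have ND := fintype.subsetP nAD.
  rewrite /At; apply: coset_idr; first by apply: ND; apply: piD.
  rewrite gmulfM gmulfV gmulfXn b'E.
  rewrite morphM ?morphV ?morphX ?groupV ?groupX ?ND //; last exact: piD.
  by rewrite /= bB; apply: (mulgI (B ^+ j)); rewrite mulVKg mulg1.
pose W w := exists2 u, At u & w = [~ u, b'].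
have WM v w : W v -> W w -> W (v * w).
  move=> [u Au ->] [t At_t ->]; exists (u * t); first exact: AtM.
  have tC : t^-1 * (u^-1 * u ^ b') = u^-1 * u ^ b' * t^-1.
    by apply: AtC; [apply: AtV | apply: AtM; [apply: AtV | apply: AtJ]].
  by rewrite !commgEl conjMg invgM [RHS]mulgA -[in RHS](mulgA t^-1) tC -!mulgA.
have WV w : W w -> W w^-1.
  move=> [u Au ->]; exists u^-1; first exact: AtV.
  rewrite !commgEl invgM !invgK conjVg; apply: AtC => //; last exact/AtV/AtJ.
have W1 : W 1 by exists 1; [rewrite /At gmulf1 group1 | rewrite comm1g].
have WX u j : At u -> W [~ u, b' ^+ j].
  move=> Au; elim: j => [|j IH]; first by rewrite commg1.
  rewrite expgSr (_ : [~ _, _] = [~ u, b' ^+ j] * [~ u ^ (b' ^+ j), b']).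
    by apply: WM => //; exists (u ^ (b' ^+ j)) => //; apply: AtJ.
  by rewrite !commgEl conjgM -mulgA mulVKg.
move=> x Dx; have [u _ ->] : W x; last exact: phiCP.
elim/derived_ind_mul: Dx => // y z _ _.
have [i [u [Au ->]]] := dec y; have [j [v [Av ->]]] := dec z.
have -> : [~ b' ^+ i * u, b' ^+ j * v] = [~ u, b' ^+ j] * [~ v, b' ^+ i]^-1.
  have bC : b' ^- j * b' ^+ i = b' ^+ i * b' ^- j.
    by apply/commute_sym/commuteV/commuteX2.
  transitivity (u^-1 * (v^-1 ^ (b' ^+ i) * u ^ (b' ^+ j)) * v).
    rewrite commgEl !conjgE !invgM -!mulgA; do 3!congr (_ * _).
    by rewrite (mulgA (b' ^- j)) bC -!mulgA.
  rewrite (AtC (v^-1 ^ _)) ?commgEl; do ?[exact/AtJ/AtV|exact: AtJ].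
  by rewrite invgM invgK conjVg !mulgA.
by apply: WM; [apply: WX | apply/WV/WX].
Qed.
End Metacyclic.

(** * Three-cycles and even permutations *)

Section ThreeCycles.
Variable T : finType.
Implicit Types (a b c d x : T) (s t : {perm T}) (S : {set T}).

Definition distinct3 a b c := [/\ a <> b, a <> c & b <> c].
Definition distinct4 a b c d :=
  [/\ distinct3 a b c, a <> d, b <> d & c <> d].

(** The cycle [a -> b -> c -> a]; locked, lest rewriting rules for products
    apply to the two transpositions. *)
Definition cyc3 a b c : {perm T} := locked (tperm a b * tperm a c).

Lemma cyc3_unlock a b c : cyc3 a b c = tperm a b * tperm a c.
Proof. by rewrite /cyc3 -lock. Qed.

Lemma cyc3E a b c x : distinct3 a b c ->
  cyc3 a b c x =
    if x == a then b else if x == b then c else if x == c then a else x.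
Proof.
move=> [ab ac bc]; rewrite cyc3_unlock permM.
case: eqP => [->|xa]; first by rewrite tpermL tpermD //; apply/eqP; congruence.
case: eqP => [->|xb]; first by rewrite tpermR tpermL.
rewrite (@tpermD _ a b); try (apply/eqP; congruence).
case: eqP => [->|xc]; rewrite ?tpermR //.
by rewrite tpermD //; apply/eqP; congruence.
Qed.

Lemma cyc3J a b c s : cyc3 a b c ^ s = cyc3 (s a) (s b) (s c).
Proof. by rewrite !cyc3_unlock conjMg !tpermJ. Qed.

Lemma cyc3_even a b c : distinct3 a b c -> cyc3 a b c = false :> bool.
Proof.
move=> [/eqP ab /eqP ac _].
by rewrite cyc3_unlock odd_permM !odd_tperm ab ac.
Qed.

Lemma cyc3V a b c : (cyc3 a b c)^-1 = cyc3 a c b.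
Proof. by rewrite !cyc3_unlock invgM !tpermV. Qed.

Lemma distinct3_perm s a b c :
  distinct3 a b c -> distinct3 (s a) (s b) (s c).
Proof. by move=> [ab ac bc]; split=> /perm_inj. Qed.

Ltac eq_cases :=
  repeat (match goal with |- context [?u == ?v] =>
    is_var u; is_var v; case: (u =P v) => ? /= end; try congruence);
  try congruence.

Ltac cyc3_eval :=
  apply/permP => ?; rewrite -?mulgA ?perm1 !(permM (cyc3 _ _ _)) !cyc3E;
  [|do ?split; congruence ..];
  eq_cases.

Lemma cyc3_cube a b c : distinct3 a b c -> cyc3 a b c ^+ 3 = 1.
Proof.
move=> [ab ac bc]; rewrite !expgS expg0 mulg1; cyc3_eval.
Qed.

Lemma cyc3_rev a b c : distinct3 a b c -> cyc3 a b c * cyc3 c b a = 1.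
Proof. by move=> [ab ac bc]; cyc3_eval. Qed.

(** Both factors send [b] to [c], and the product is a double transposition. *)
Lemma cyc3_klein a b c d : distinct4 a b c d ->
  (cyc3 a b c * cyc3 d b c) ^+ 2 = 1.
Proof.
move=> [[ab ac bc] ad bd cd]; rewrite !expgS expg0 mulg1; cyc3_eval.
Qed.

Lemma cyc3_comm a b c d e : distinct4 a b c d -> a <> e -> b <> e ->
  c <> e -> d <> e -> cyc3 a b c = [~ cyc3 d b a, cyc3 b c e].
Proof.
move=> [[ab ac bc] ad bd cd] ae be ce de.
rewrite commgEl cyc3V cyc3J.
have D : distinct3 b c e by [].
rewrite !(cyc3E _ D).
have -> : d == b = false by apply/eqP; congruence.
have -> : d == c = false by apply/eqP; congruence.
have -> : d == e = false by apply/eqP; congruence.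
have -> : a == b = false by apply/eqP; congruence.
have -> : a == c = false by apply/eqP; congruence.
have -> : a == e = false by apply/eqP; congruence.
rewrite eqxx; cyc3_eval.
Qed.

(** Even permutations supported in [S] are products of 3-cycles in [S]: if [s]
    moves [x], it moves a point [z] other than [x] and [s x], unless it is a
    transposition, and dividing by the cycle [x -> s x -> z -> x] yields a
    permutation that fixes [x] and every fixed point of [s]. *)
Lemma even_perm_ind S (Q : {perm T} -> Prop) :
  Q 1 -> (forall s t, Q s -> Q t -> Q (s * t)) ->
  (forall a b c, a \in S -> b \in S -> c \in S -> distinct3 a b c ->
     Q (cyc3 a b c)) ->
  forall s, perm_on S s -> s = false :> bool -> Q s.
Proof.
move=> Q1 QM Qcyc s; have [n] := ubnP #|[set x | s x != x]|.
elim: n s => // n IHn s; rewrite ltnS => le_n Ss evs.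
case: (pickP [pred x | s x != x]) => [x /= sx|s1]; last first.
  rewrite (_ : s = 1) //; apply/permP => x; rewrite perm1.
  by have /= := s1 x; case: eqP.
case: (pickP [pred z | [&& s z != z, z != x & z != s x]]) => [z /=|noz].
  move=> /and3P[/eqP sz /eqP zx /eqP zy]; move/eqP: sx => sx.
  have D : distinct3 x (s x) z by split; congruence.
  have mS u : s u <> u -> u \in S.
    by move=> su; apply: contraT => /(out_perm Ss) /su.
  have ssx : s (s x) <> s x by move=> /perm_inj.
  rewrite -(mulgVK (cyc3 x (s x) z) s); apply: (QM); last first.
    by apply: Qcyc => //; apply: mS.
  have fixed u : s u = u -> (s * (cyc3 x (s x) z)^-1) u = u.
    move=> su; rewrite permM su cyc3V cyc3E; last by split; congruence.
    by do ?(case: eqP => ?); congruence.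
  have fixx : (s * (cyc3 x (s x) z)^-1) x = x.
    rewrite permM cyc3V cyc3E; last by split; congruence.
    by do ?(case: eqP => ?); congruence.
  apply: IHn.
  - apply: leq_trans le_n; apply: proper_card; apply/properP; split.
      apply/fintype.subsetP => u; rewrite !inE; apply: contra => /eqP su.
      by apply/eqP/fixed.
    by exists x; rewrite !inE ?fixx ?eqxx //; apply/eqP.
  - apply/fintype.subsetP => u; rewrite inE => mu.
    by apply: mS => su; case/eqP: mu; apply: fixed.
  - by rewrite odd_permM odd_permV cyc3_even // addbF.
exfalso; move/eqP: sx => sx.
have noz' z : z <> x -> z <> s x -> s z = z.
  move=> /eqP zx /eqP zy; have /= := noz z; rewrite zx zy !andbT.
  by case: eqP.
have ssx : s (s x) = x.
  case: (s (s x) =P x) => // ssx.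
  by have /perm_inj/perm_inj := noz' _ ssx (fun e => sx (perm_inj e)).
have sE : s = tperm x (s x).
  apply/permP => z; case: tpermP => [->|->|zx zy] //.
  exact: noz'.
by move: evs; rewrite sE odd_tperm; move/eqP: sx; rewrite eq_sym => ->.
Qed.

End ThreeCycles.

(** The image of a 3-cycle has odd order, hence is even. *)
Lemma even_endomorphism (T : finType) (alpha : {perm T} -> {perm T})
    (s : {perm T}) :
  {morph alpha : s t / s * t} -> s = false :> bool -> alpha s = false :> bool.
Proof.
move=> alphaM; have a1 := mul_morph1 alphaM.
apply: (even_perm_ind (S := finset.setT)
  (Q := fun s => alpha s = false :> bool)).
- by rewrite a1 odd_perm1.
- by move=> u v; rewrite alphaM odd_permM => -> ->.
- move=> a b c _ _ _ D; have := congr1 alpha (cyc3_cube D).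
  rewrite !expgS expg0 mulg1 !alphaM a1 => /(congr1 (@odd_perm T)).
  by rewrite !odd_permM odd_perm1; case: (odd_perm _).
- by apply/fintype.subsetP => u; rewrite inE.
Qed.

(** * Central extensions of alternating groups *)

Section Lifts.
Variables (T : finType) (E : groupType) (pi : {hom E -> {perm T}}).
Hypothesis pi_even : forall x, pi x = false :> bool.
Hypothesis pi_surj :
  forall s : {perm T}, s = false :> bool -> exists x, pi x = s.
Hypothesis pi_central : forall z, pi z = 1 -> central z.

Let piM x y : pi (x * y) = pi x * pi y. Proof. exact: gmulfM. Qed.
Let piV x : pi x^-1 = (pi x)^-1. Proof. exact: gmulfV. Qed.
Let piR x y : pi [~ x, y] = [~ pi x, pi y]. Proof. exact: gmulfR. Qed.
Let piJ x y : pi (x ^ y) = pi x ^ pi y. Proof. exact: gmulfJ. Qed.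

Hypothesis cardT : #|T| = 5 \/ 8 <= #|T|.

Lemma cards3 (a b c : T) : distinct3 a b c -> #|[set a; b; c]| = 3.
Proof.
move=> [/eqP/negPf ab /eqP/negPf ac /eqP/negPf bc].
by rewrite -finset.setUA !cardsU1 cards1 !inE ab ac bc.
Qed.

Lemma pick_notin (s : seq T) : (size s < #|T|)%N ->
  exists x, all (fun y => x != y) s.
Proof.
move=> ltsT; case: (pickP [pred x | x \notin s]) => [x /= xs|all_s].
  by exists x; apply/allP => y ys; apply: contraNneq xs => ->.
suff : (#|T| <= size s)%N by rewrite leqNgt ltsT.
apply: leq_trans (card_size s); apply: subset_leq_card.
by apply/fintype.subsetP => x _; have /negbFE := all_s x.
Qed.

(** The elements over the pointwise stabilizer of [a], [b], [c] in the
    alternating group commute with [X] modulo the kernel, so products of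
    commutators of such elements commute with [X].  That stabilizer is trivial
    for [#|T| = 5], and for [#|T| >= 8] it is perfect, as any 3-cycle is a
    commutator of 3-cycles in a set of 5 points.  For 6 or 7 points it is
    neither. *)
Lemma stabilizer_commute a b c X y : distinct3 a b c -> pi X = cyc3 a b c ->
  pi y a = a -> pi y b = b -> pi y c = c -> commute X y.
Proof.
move=> abc piX ya yb yc; have [ab ac bc] := abc.
pose S : {set T} := ~: [set a; b; c].
have inS u : (u \in S) = [&& u != a, u != b & u != c].
  by rewrite !inE !negb_or andbA.
have cardS : (#|S| + 3 = #|T|)%N.
  by rewrite addnC -(cards3 abc) cardsC.
have Sy : perm_on S (pi y).
  apply/fintype.subsetP => u; rewrite inE inS.
  by apply: contraR; rewrite !negb_and !negbK => /or3P[] /eqP->; apply/eqP.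
pose Q s := exists2 z, pi z = s & commute X z.
suff [z zy Xz] : Q (pi y).
  have [t ct ->] := fiber_central pi_central (esym zy).
  by apply: commuteM => //; apply/commute_sym.
have S5 u v w : u \in S -> v \in S -> w \in S -> distinct3 u v w ->
    (5 <= #|S|)%N.
  move=> uS vS wS [uv uw vw].
  case: cardT => [T5|]; last by rewrite -cardS; case: #|S| => [|[|[|[|[|]]]]].
  have : [set u; v; w] \subset S.
    apply/fintype.subsetP => x; rewrite !inE => /orP[/orP[]|] /eqP->;
      by move: uS vS wS; rewrite !inE.
  move/subset_leq_card; rewrite cards3 //.
  by move: cardS; rewrite T5 -[5]/(2 + 3)%N => /addIn ->.
apply: (even_perm_ind (S := S) (Q := Q)) => //.
- by exists 1; [exact: gmulf1 | exact: commute1].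
- move=> s t [u <- Xu] [v <- Xv]; exists (u * v); first exact: piM.
  exact: commuteM.
move=> u v w uS vS wS uvw.
have Sge5 := S5 _ _ _ uS vS wS uvw; have [uv uw vw] := uvw.
have T8 : (8 <= #|T|)%N by rewrite -cardS -[8]/(5 + 3)%N leq_add2r.
have [p /= /and5P[pu pv pw pa /and3P[pb pc _]]] :=
  @pick_notin [:: u; v; w; a; b; c] (leq_trans (isT : 6 < 8) T8).
have [q /= /and5P[qu qv qw qp /and4P[qa qb qc _]]] :=
  @pick_notin [:: u; v; w; p; a; b; c] T8.
have pS : p \in S by rewrite inS pa pb.
have qS : q \in S by rewrite inS qa qb.
have XC f g h z : f \in S -> g \in S -> h \in S ->
    pi z = cyc3 f g h -> exists2 t, central t & z ^ X = z * t.
  move=> fS gS hS zE; exists [~ z, X]; last by rewrite commgEl mulVKg.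
  apply: pi_central; rewrite piR zE piX; apply/eqP.
  rewrite -conjg_fix cyc3J.
  have fixS k : k \in S -> cyc3 a b c k = k.
    by rewrite inS cyc3E // => /and3P[/negPf-> /negPf-> /negPf->].
  by rewrite !fixS.
have D1 : distinct3 p v u by split; [apply/eqP|apply/eqP|congruence].
have D2 : distinct3 v w q by split; [|apply/eqP; rewrite eq_sym..].
have [x xE] := pi_surj (cyc3_even D1).
have [z zE] := pi_surj (cyc3_even D2).
exists [~ x, z].
  rewrite piR xE zE -cyc3_comm //; first split=> //;
  by apply/eqP; rewrite // eq_sym.
have [t1 ct1 xX] := XC _ _ _ _ pS vS uS xE.
have [t2 ct2 zX] := XC _ _ _ _ vS wS qS zE.
apply/commute_sym/commgP; rewrite -conjg_fix; apply/eqP.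
by rewrite conjRg xX zX commg_centralM.
Qed.

Lemma perm_distinct4 (a b c d a' b' c' d' : T) :
  distinct4 a b c d -> distinct4 a' b' c' d' ->
  exists s : {perm T}, [/\ s a = a', s b = b', s c = c' & s d = d'].
Proof.
move=> [[ab ac bc] ad bd cd] [[ab' ac' bc'] ad' bd' cd'].
pose s1 := tperm a a'; have s1a : s1 a = a' by rewrite tpermL.
pose s2 := s1 * tperm (s1 b) b'.
have s2a : s2 a = a'.
  rewrite permM s1a tpermD //; apply/eqP; last by congruence.
  by rewrite -s1a => /perm_inj; congruence.
have s2b : s2 b = b' by rewrite permM tpermL.
pose s3 := s2 * tperm (s2 c) c'.
have s3a : s3 a = a'.
  rewrite permM s2a tpermD //; apply/eqP; last by congruence.
  by rewrite -s2a => /perm_inj; congruence.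
have s3b : s3 b = b'.
  rewrite permM s2b tpermD //; apply/eqP; last by congruence.
  by rewrite -s2b => /perm_inj; congruence.
have s3c : s3 c = c' by rewrite permM tpermL.
exists (s3 * tperm (s3 d) d'); split; rewrite permM ?tpermL //.
- rewrite s3a tpermD //; apply/eqP; last by congruence.
  by rewrite -s3a => /perm_inj; congruence.
- rewrite s3b tpermD //; apply/eqP; last by congruence.
  by rewrite -s3b => /perm_inj; congruence.
- rewrite s3c tpermD //; apply/eqP; last by congruence.
  by rewrite -s3c => /perm_inj; congruence.
Qed.

Let cardT5 : (5 <= #|T|)%N.
Proof. by case: cardT => [->//|]; apply: leq_trans. Qed.

Lemma ex_distinct4 : exists a b c d : T, distinct4 a b c d.
Proof.
have [a _] := @pick_notin [::] (leq_trans (isT : 0 < 5) cardT5).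
have [b /= /andP[/eqP ba _]] :=
  @pick_notin [:: a] (leq_trans (isT : 1 < 5) cardT5).
have [c /= /and3P[/eqP ca /eqP cb _]] :=
  @pick_notin [:: a; b] (leq_trans (isT : 2 < 5) cardT5).
have [d /= /and4P[/eqP da /eqP db /eqP dc _]] :=
  @pick_notin [:: a; b; c] (leq_trans (isT : 3 < 5) cardT5).
by exists a, b, c, d; do !split; congruence.
Qed.

(** Parity is corrected by a transposition of two further points. *)
Lemma lift_distinct3 (a b c a' b' c' : T) :
  distinct3 a b c -> distinct3 a' b' c' ->
  exists e, [/\ pi e a = a', pi e b = b' & pi e c = c'].
Proof.
move=> D D'.
have [d /= /and4P[/eqP da /eqP db /eqP dc _]] :=
  @pick_notin [:: a; b; c] (ltnW cardT5).
have [d' /= /and4P[/eqP da' /eqP db' /eqP dc' _]] :=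
  @pick_notin [:: a'; b'; c'] (ltnW cardT5).
have [e' /= /and5P[/eqP ea' /eqP eb' /eqP ec' /eqP ed' _]] :=
  @pick_notin [:: a'; b'; c'; d'] cardT5.
have D4 : distinct4 a b c d by case: D => *; do !split; congruence.
have D4' : distinct4 a' b' c' d' by case: D' => *; do !split; congruence.
have [s [sa sb sc sd]] := perm_distinct4 D4 D4'.
case: (boolP (odd_perm s)) => [odds|/negbTE evs]; last first.
  by have [e eE] := pi_surj evs; exists e; rewrite eE.
have [|e eE] := pi_surj (s := s * tperm d' e').
  rewrite odd_permM odds odd_tperm; case: eqP => // de; congruence.
by exists e; rewrite eE !permM sa sb sc !tpermD //; apply/eqP; congruence.
Qed.

(** The conjugates of one lift of one 3-cycle; [stabilizer_commute] says that
    each of them only depends on the 3-cycle below. *)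
Lemma equivariant_lifts :
  exists X : T -> T -> T -> E, forall a b c, distinct3 a b c ->
    pi (X a b c) = cyc3 a b c /\
    forall e, X a b c ^ e = X (pi e a) (pi e b) (pi e c).
Proof.
have [a0 [b0 [c0 [_ [D0 _ _ _]]]]] := ex_distinct4.
have [X0 X0E] := pi_surj (cyc3_even D0).
have uniq e e' : pi e a0 = pi e' a0 -> pi e b0 = pi e' b0 ->
    pi e c0 = pi e' c0 -> X0 ^ e = X0 ^ e'.
  move=> ea eb ec; apply: (conjg_inj e'^-1); rewrite conjgK -conjgM.
  apply/eqP; rewrite conjg_fix; apply/commgP.
  by apply: (stabilizer_commute D0 X0E);
    rewrite piM piV permM ?ea ?eb ?ec permK.
have [|X XP] := @choice (T * T * T)%type E (fun t x =>
    distinct3 t.1.1 t.1.2 t.2 -> exists e,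
      [/\ x = X0 ^ e, pi e a0 = t.1.1, pi e b0 = t.1.2 & pi e c0 = t.2]).
  move=> [[a b] c] /=.
  case: (pselect (distinct3 a b c)) => [D|]; last by exists 1.
  by have [e [ea eb ec]] := lift_distinct3 D0 D; exists (X0 ^ e) => _; exists e.
exists (fun a b c => X (a, b, c)) => a b c D.
have [e /= [-> ea eb ec]] := XP (a, b, c) D.
split=> [|e1]; first by rewrite piJ X0E cyc3J ea eb ec.
have [e2 /= [-> ea2 eb2 ec2]] := XP (_, _, _) (distinct3_perm (pi e1) D).
by rewrite -conjgM; apply: uniq; rewrite piM permM ?ea ?eb ?ec ?ea2 ?eb2 ?ec2.
Qed.

Record cycle_lifts (Z : T -> T -> T -> E) : Prop := {
  cycle_lift_pi : forall a b c, distinct3 a b c -> pi (Z a b c) = cyc3 a b c;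
  cycle_liftJ : forall a b c e, distinct3 a b c ->
    Z a b c ^ e = Z (pi e a) (pi e b) (pi e c);
  cycle_lift_cube : forall a b c, distinct3 a b c -> Z a b c ^+ 3 = 1;
  cycle_liftV : forall a b c, distinct3 a b c -> (Z a b c)^-1 = Z c b a
}.

Let distinct3_rev (a b c : T) : distinct3 a b c -> distinct3 c b a.
Proof. by move=> [ab ac bc]; split; congruence. Qed.

(** For equivariant lifts [X], the products [X a b c * X c b a] and the cubes
    [X a b c ^+ 3] are central and constant, equal to [m] and [k] say.  Cubing
    the relation [X c b a = (X a b c)^-1 * m] gives [m ^+ 3 = k ^+ 2], so that
    the lifts [X a b c * (m * k^-1)] satisfy both normalizations at once. *)
Lemma cycle_lifts_exist : exists Z, cycle_lifts Z.
Proof.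
have [X XP] := equivariant_lifts.
have Xpi a b c (D : distinct3 a b c) : pi (X a b c) = cyc3 a b c.
  by case: (XP a b c D).
have XJ a b c e (D : distinct3 a b c) :
  X a b c ^ e = X (pi e a) (pi e b) (pi e c) by case: (XP a b c D).
have [a0 [b0 [c0 [_ [D0 _ _ _]]]]] := ex_distinct4.
pose m := X a0 b0 c0 * X c0 b0 a0; pose k := X a0 b0 c0 ^+ 3.
have cm : central m.
  apply: pi_central; rewrite piM !Xpi ?cyc3_rev //; exact: distinct3_rev.
have ck : central k.
  by apply: pi_central; rewrite /k gmulfXn /= Xpi // cyc3_cube.
have cJ (z e : E) : central z -> z ^ e = z.
  by move=> cz; rewrite conjgE cz mulKg.
have mE a b c : distinct3 a b c -> X a b c * X c b a = m.
  move=> D; have [e [ea eb ec]] := lift_distinct3 D0 D.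
  rewrite -(cJ m e cm) conjMg !XJ ?ea ?eb ?ec //; exact: distinct3_rev.
have kE a b c : distinct3 a b c -> X a b c ^+ 3 = k.
  move=> D; have [e [ea eb ec]] := lift_distinct3 D0 D.
  by rewrite -(cJ k e ck) conjXg !XJ ?ea ?eb ?ec.
have mk : m ^+ 3 = k ^+ 2.
  have D0' := distinct3_rev D0.
  have E1 : X c0 b0 a0 = (X a0 b0 c0)^-1 * m by rewrite mulKg.
  have := kE _ _ _ D0'; rewrite E1 expgMn; last exact/commute_sym.
  rewrite expVgn -/k => kk; rewrite -[LHS](mulVKg k) kk.
  by rewrite !expgS expg0 mulg1.
pose w := m * k^-1.
have cw : central w by apply: centralM => //; apply: centralV.
have w3 : w ^+ 3 = k^-1.
  rewrite expgMn; last exact: cm.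
  rewrite mk expVgn (expgSr k 2) invgM mulgA -[RHS]mulg1 -(mulgV (k ^+ 2)).
  by rewrite mulgA -(centralV ck).
have w2 : w ^+ 2 = m^-1.
  apply: (mulgI w); rewrite -expgS w3 /w -(centralV ck) mulgK //.
exists (fun a b c => X a b c * w); split=> [a b c D|a b c e D|a b c D|a b c D].
- rewrite piM Xpi // (_ : pi w = 1) ?mulg1 //.
  rewrite /w piM piV /k gmulfXn /= /m piM !Xpi //; last exact: distinct3_rev.
  by rewrite cyc3_rev // cyc3_cube // invg1 mulg1.
- by rewrite conjMg (cJ w) // XJ.
- by rewrite expgMn ?kE ?w3 ?mulgV //; apply/commute_sym.
- apply: mulg1_eq; rewrite -mulgA (mulgA w) cw -(mulgA (X c b a)) mulgA mE //.
  by rewrite -[w * w]/(w ^+ 2) w2 mulgV.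
Qed.

Section Span.
Variable Z : T -> T -> T -> E.
Hypothesis ZP : cycle_lifts Z.

Let Zpi := cycle_lift_pi ZP.
Let ZJ := cycle_liftJ ZP.
Let ZV := cycle_liftV ZP.

Lemma Zsq a b c : distinct3 a b c -> Z a b c * Z a b c = Z c b a.
Proof.
move=> D; rewrite -(ZV D); apply/esym/mulg1_eq.
by have := cycle_lift_cube ZP D; rewrite !expgS expg0 mulg1.
Qed.

Lemma Zrot a b c : distinct3 a b c -> Z b c a = Z a b c.
Proof.
move=> D; have := ZJ (Z a b c) D; rewrite conjgE mulKg Zpi // !cyc3E // !eqxx.
case: D => [/eqP/negPf ab /eqP/negPf ac /eqP/negPf bc].
by rewrite [b == a]eq_sym ab [c == a]eq_sym ac [c == b]eq_sym bc.
Qed.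

(** Pairs of 3-cycles of the same shape are conjugate under all permutations
    of four points by elements of the symmetric group; an odd conjugating
    element is made even by exchanging [a] and [d], which replaces the product
    by its conjugate [Z d b c * Z a b c]. *)
Lemma klein_const : exists delta, central delta /\
  forall a b c d, distinct4 a b c d -> (Z a b c * Z d b c) ^+ 2 = delta.
Proof.
have [a0 [b0 [c0 [d0 D0]]]] := ex_distinct4.
have [[ab0 ac0 bc0] ad0 bd0 cd0] := D0.
have d3 a b c d : distinct4 a b c d -> distinct3 d b c.
  by move=> [[ab ac bc] ad bd cd]; split; congruence.
have cd a b c d : distinct4 a b c d -> central ((Z a b c * Z d b c) ^+ 2).
  move=> D; apply: pi_central; have [D3 _ _ _] := D.
  by rewrite gmulfXn /= piM !Zpi ?cyc3_klein //; apply: d3 D.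
have cJ (z e : E) : central z -> z ^ e = z.
  by move=> cz; rewrite conjgE cz mulKg.
exists ((Z a0 b0 c0 * Z d0 b0 c0) ^+ 2); split; first exact: cd.
move=> a b c d D; have [D3 _ _ _] := D; have [D03 _ _ _] := D0.
have [s [sa sb sc sd]] := perm_distinct4 D0 D.
case: (boolP (odd_perm s)) => [odds|/negbTE evs]; last first.
  have [e eE] := pi_surj evs.
  rewrite -(cJ _ e (cd _ _ _ _ D0)) conjXg conjMg !ZJ ?eE ?sa ?sb ?sc ?sd //.
  exact: d3 D0.
have [|e eE] := pi_surj (s := tperm a0 d0 * s).
  by rewrite odd_permM odds odd_tperm; case: eqP => // ad; congruence.
have E1 : (Z d b c * Z a b c) ^+ 2 = (Z a0 b0 c0 * Z d0 b0 c0) ^+ 2.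
  rewrite -(cJ _ e (cd _ _ _ _ D0)) conjXg conjMg !ZJ ?eE //; last exact: d3 D0.
  rewrite !permM tpermL tpermR (@tpermD _ a0 d0 b0) ?(@tpermD _ a0 d0 c0);
    try (apply/eqP; congruence).
  by rewrite sa sb sc sd.
rewrite -E1 -[LHS](cJ _ (Z a b c)); last exact: cd.
by rewrite conjXg conjgE !mulgA mulVg mul1g.
Qed.

Variable delta : E.
Hypothesis delta_central : central delta.
Hypothesis klein : forall a b c d, distinct4 a b c d ->
  (Z a b c * Z d b c) ^+ 2 = delta.

(** The inverse of [Z a b c * Z d b c] is a product of the same shape. *)
Lemma delta2 : delta * delta = 1.
Proof.
have [a [b [c [d D]]]] := ex_distinct4.
have [[ab ac bc] ad bd cd] := D.
have D' : distinct4 d c b a by do !split; congruence.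
have E1 : (Z a b c * Z d b c)^-1 = Z d c b * Z a c b.
  rewrite invgM !ZV; try (split; congruence).
  by rewrite (@Zrot a c b) ?(@Zrot d c b) //; split; congruence.
by rewrite -{1}(klein D') -E1 expVgn klein // mulVg.
Qed.

(** With [x = Z a b c] and [y = Z d b c], the elements [u = x * y] and
    [v = y * x] lie over commuting double transpositions, and [u], [v] and
    [u * v] all have square [delta].  If [phi delta = 1], the images of [u] and
    [v] generate an elementary abelian group, so [u] and [v] commute and
    [delta * delta = delta]. *)
Lemma delta_kernel (K : groupType) (phi : {hom E -> K}) :
  commutativity_preserving phi -> phi delta = 1 -> delta = 1.
Proof.
have [a [b [c [d D]]]] := ex_distinct4.
have [[ab ac bc] ad bd cd] := D.
have D' : distinct4 d b c a by do !split; congruence.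
have D'' : distinct4 a c b d by do !split; congruence.
have [D3 _ _ _] := D; have [D3' _ _ _] := D'.
pose x := Z a b c; pose y := Z d b c.
pose u := x * y; pose v := y * x.
have u2 : u * u = delta by rewrite -(klein D) !expgS expg0 mulg1.
have v2 : v * v = delta by rewrite -(klein D') !expgS expg0 mulg1.
have uv2 : (u * v) * (u * v) = delta.
  have xV : x^-1 = x * x by rewrite Zsq // ZV.
  have yV : y^-1 = y * y by rewrite Zsq // ZV.
  have xVV : x^-1 * x^-1 = x by rewrite {1}xV -mulgA mulgV mulg1.
  have -> : u * v = (x^-1 * y^-1) ^ x.
    by rewrite conjgE !mulgA xVV yV !mulgA.
  rewrite -conjMg (_ : x^-1 * y^-1 * (x^-1 * y^-1) = delta).
    by rewrite conjgE delta_central mulKg.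
  have -> : x^-1 * y^-1 = Z a c b * Z d c b.
    rewrite /x /y !ZV // (@Zrot a c b); last by split; congruence.
    by rewrite (@Zrot d c b) //; split; congruence.
  by rewrite -(klein D'') !expgS expg0 mulg1.
move=> phiCP phi1.
have uvC : commute u v.
  apply/commgP/eqP/phiCP; rewrite gmulfR; apply/eqP/commgP.
  have p2 : phi u * phi u = 1 by rewrite -gmulfM u2.
  have q2 : phi v * phi v = 1 by rewrite -gmulfM v2.
  have pq2 : phi u * phi v * (phi u * phi v) = 1 by rewrite -!gmulfM uv2.
  move: (phi u) (phi v) p2 q2 pq2 => p q p2 q2 pq2.
  rewrite /commute; apply: (mulgI (p * q)); rewrite pq2 -mulgA (mulgA q) q2.
  by rewrite mul1g p2.
have : delta * delta = delta.
  have := uv2; rewrite -(mulgA u v) (mulgA v u) -uvC -(mulgA u v v) v2 mulgA.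
  by rewrite u2.
by rewrite -{3}[delta]mulg1 => /mulgI.
Qed.

(** The subgroup generated by [delta] and the lifts of the 3-cycles in [S]. It
    is described by right multiplication because [span_cosets] enumerates
    right cosets. *)
Inductive span (S : {set T}) : E -> Prop :=
  | span1 : span S 1
  | spanZ x a b c : span S x -> a \in S -> b \in S -> c \in S ->
      distinct3 a b c -> span S (x * Z a b c)
  | span_delta x : span S x -> span S (x * delta).

Lemma spanM S x y : span S x -> span S y -> span S (x * y).
Proof.
move=> Sx; elim=> [|y' a b c _ IH aS bS cS D|y' _ IH]; first by rewrite mulg1.
  by rewrite mulgA; apply: spanZ.
by rewrite mulgA; apply: span_delta.
Qed.

Lemma span_gen (S : {set T}) a b c : a \in S -> b \in S -> c \in S ->
  distinct3 a b c -> span S (Z a b c).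
Proof.
move=> aS bS cS D; rewrite -[Z a b c]mul1g.
by apply: spanZ => //; constructor.
Qed.

Lemma span_delta1 S : span S delta.
Proof. by rewrite -[delta]mul1g; apply: span_delta; constructor. Qed.

Lemma span_fix S x m : span S x -> m \notin S -> pi x m = m.
Proof.
move=> + mS; elim=> [|y a b c _ IH aS bS cS D|y _ IH].
- by rewrite gmulf1 perm1.
- rewrite piM permM IH Zpi // cyc3E //.
  have neq z : z \in S -> m == z = false.
    by move=> zS; apply: contraNF mS => /eqP->.
  by rewrite !neq.
- rewrite piM permM IH (_ : pi delta = 1) ?perm1 //.
  have [a [b [c [d D]]]] := ex_distinct4.
  have [[ab ac bc] ad bd cd] := D.
  rewrite -(klein D) gmulfXn /= piM !Zpi ?cyc3_klein //; split; congruence.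
Qed.

Lemma kleinV a b c d : distinct4 a b c d ->
  (Z a b c)^-1 * (Z d b c)^-1 = delta * (Z d b c * Z a b c).
Proof.
move=> D; have [D3 ad bd cd] := D.
have D' : distinct4 d b c a by case: D3 => *; do !split; congruence.
rewrite -invgM; apply/mulg1_eq; rewrite mulgA -delta_central -mulgA.
by rewrite -[X in delta * X]/((Z d b c * Z a b c) ^+ 2) klein // delta2.
Qed.

(** The relation of the alternating group of degree 4 for two 3-cycles with a
    common edge [m -> l]: their quotient is a 3-cycle, which lifts correctly
    up to [delta]. *)
Lemma same_head k k' m l : distinct4 k m l k' ->
  Z k m l * (Z k' m l)^-1 = delta * Z k' l k.
Proof.
move=> D; have [D3 kk' mk' lk'] := D; have [km kl ml] := D3.
have D3' : distinct3 k' m l by split; congruence.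
have <- : Z k' m l ^ Z k m l = Z k' l k.
  rewrite ZJ // Zpi // !cyc3E // !eqxx.
  by do ![case: eqP => //= ?]; congruence.
have -> : (Z k' m l)^-1 = Z k m l * (delta * (Z k' m l * Z k m l)).
  by rewrite -kleinV // mulVKg.
by rewrite conjgE mulgA Zsq // -ZV // mulgA -delta_central -mulgA.
Qed.

(** The same relation for the inverse of [Z l m q], which shares the edge
    [m -> q] with [Z p m q]. *)
Lemma edge_quotient l m q p : distinct4 l m q p ->
  Z q m l * Z p m q = delta * Z p m l.
Proof.
move=> D; have [D3 lp mp qp] := D; have [lm lq mq] := D3.
have D3' : distinct3 p m q by split; congruence.
have Dr : distinct3 q m p by split; congruence.
have Dp : distinct3 l p m by split; congruence.
rewrite -(ZV D3) (Zrot Dp).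
have <- : Z l m q ^ (Z p m q)^-1 = Z l p m.
  rewrite (ZV D3') ZJ // Zpi // !cyc3E // !eqxx.
  by do ![case: eqP => //= ?]; congruence.
have {1}-> : Z p m q = (Z p m q)^-1 * (Z p m q)^-1.
  by rewrite (ZV D3') Zsq.
by rewrite mulgA kleinV // conjgE invgK -!mulgA.
Qed.

(** The coset of [Z k m l] only depends on the image [l] of [m]. *)
Lemma change_head (S : {set T}) t k k' m l : span S t -> k \in S -> k' \in S ->
  l \in S -> m \notin S -> k <> l -> k' <> l ->
  exists2 t', span S t' & t * Z k m l = t' * Z k' m l.
Proof.
move=> St kS k'S lS mS kl k'l.
have mN u : u \in S -> m <> u by move=> uS mu; move: mS; rewrite mu uS.
have [mk mk' ml] := And3 (mN k kS) (mN k' k'S) (mN l lS).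
case: (k =P k') => [->|kk']; first by exists t.
exists (t * (delta * Z k' l k)).
  apply: spanM St _; apply: spanM; first exact: span_delta1.
  by apply: span_gen => //; split; congruence.
rewrite -(@same_head k k' m l); last by do !split; congruence.
by rewrite !mulgA mulgVK.
Qed.

(** Besides [span (S :\ m)] itself there is at most one right coset for each
    image [b <> m] of [m].  The union is stable under right multiplication by a
    generator [Z p m q] because the head of [Z k m l] can be changed at will:
    taking [q], or [p] when [l = q], makes [Z k m l * Z p m q], up to [delta],
    the lift of a 3-cycle or the identity. *)
Lemma span_cosets (S : {set T}) m x : m \in S -> span S x ->
  span (S :\ m) x \/ exists a b t,
    [/\ a \in S :\ m, b \in S :\ m, a <> b, span (S :\ m) t & x = t * Z a m b].
Proof.
move=> mS; set S' := S :\ m.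
have S'P u : u \in S -> u <> m -> u \in S'.
  by move=> uS /eqP um; rewrite !inE um.
have mS' : m \notin S' by rewrite !inE eqxx.
have mN u : u \in S' -> m <> u by move=> uS mu; move: mS'; rewrite mu uS.
have step t p q : span S' t \/ (exists a b t0,
      [/\ a \in S', b \in S', a <> b, span S' t0 & t = t0 * Z a m b]) ->
    p \in S' -> q \in S' -> p <> q ->
    span S' (t * Z p m q) \/ exists a b t0,
      [/\ a \in S', b \in S', a <> b, span S' t0 & t * Z p m q = t0 * Z a m b].
  move=> [St|[k [l [t0 [kS lS kl St ->]]]]] pS qS pq.
    by right; exists p, q, t.
  have [mp mq] := (mN p pS, mN q qS); have [mk ml] := (mN k kS, mN l lS).
  have Dpq : distinct3 p m q by split; congruence.
  case: (l =P p) => [lp|lp].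
    have [|t' St' ->] := change_head St kS qS lS mS' kl; first by congruence.
    by left; rewrite lp -mulgA -(ZV Dpq) mulVg mulg1.
  case: (l =P q) => [lq|lq].
    have [|t' St' ->] := change_head St kS pS lS mS' kl; first by congruence.
    right; exists q, p, t'; split=> //; first by congruence.
    by rewrite lq -mulgA Zsq.
  have [|t' St' ->] := change_head St kS qS lS mS' kl; first by congruence.
  right; exists p, l, (t' * delta); split=> //; first by congruence.
    by apply: spanM => //; apply: span_delta1.
  by rewrite -!mulgA edge_quotient //; do !split; congruence.
elim=> [|t a b c _ IH aS bS cS D|t _ IH]; first by left; constructor.
  case: (b =P m) => [bm|bm].
    rewrite bm in D *; case: D => *; apply: step => //; try congruence;
      by apply: S'P => //; congruence.
  case: (a =P m) => [am|am].
    rewrite am in D *; have [? ? ?] := D.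
    rewrite (@Zrot c m b); last by split; congruence.
    by apply: step => //; try congruence; apply: S'P => //; congruence.
  case: (c =P m) => [cm|cm].
    rewrite cm in D *; have [? ? ?] := D; rewrite -(Zrot D).
    by apply: step => //; try congruence; apply: S'P => //; congruence.
  have [aS' bS' cS'] := And3 (S'P a aS am) (S'P b bS bm) (S'P c cS cm).
  case: IH => [St|[k [l [t0 [kS lS kl St ->]]]]]; first by left; apply: spanZ.
  right; pose s := pi (Z a b c).
  have sS u : u \in S' -> s u \in S'.
    by rewrite /s Zpi // cyc3E //; do ![case: eqP => // _].
  exists (s k), (s l), (t0 * Z a b c); split; do ?exact: sS.
  - by move/perm_inj.
  - exact: spanZ.
  rewrite -!mulgA (conjgC (Z k m l)) ZJ; last first.
    by have [? ?] := (mN k kS, mN l lS); split; congruence.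
  congr (_ * (_ * Z _ _ _)); rewrite Zpi // cyc3E //.
  by do ![case: eqP => //= ?]; congruence.
case: IH => [St|[k [l [t0 [kS lS kl St ->]]]]].
  by left; apply: span_delta.
right; exists k, l, (t0 * delta); split=> //; first exact: span_delta.
by rewrite -!mulgA delta_central.
Qed.

(** By induction on [S], removing a point [m]: an element over the identity
    fixes [m], so it belongs to the coset [span (S :\ m)]. *)
Lemma span_kernel S x : span S x -> pi x = 1 -> x = 1 \/ x = delta.
Proof.
have [n] := ubnP #|S|; elim: n S x => // n IHn S x; rewrite ltnS => le_n Sx x1.
case: (pickP [pred m | m \in S]) => [m /= mS|S0]; last first.
  elim: Sx {x1} => [|y a b c _ _ aS|y _ [->|->]]; first by left.
  - by have := S0 a; rewrite /= aS.
  - by right; rewrite mul1g.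
  - by left; rewrite delta2.
case: (span_cosets mS Sx) => [S'x|[a [b [t [aS bS ab St xE]]]]].
  apply: (IHn (S :\ m)) => //; apply: leq_trans le_n.
  by rewrite (cardsD1 m S) mS.
have [am bm] : a <> m /\ b <> m.
  by move: aS bS; rewrite !inE => /andP[/eqP ? _] /andP[/eqP ? _].
have D : distinct3 a m b by split; congruence.
have := congr1 (fun s : {perm T} => s m) x1.
rewrite xE piM permM (span_fix St) ?inE ?eqxx // Zpi // cyc3E // perm1 eqxx.
by case: eqP => // *; congruence.
Qed.

Lemma span_lift y : exists2 t, span finset.setT t & pi t = pi y.
Proof.
apply: (even_perm_ind (S := finset.setT)
  (Q := fun s => exists2 t, span finset.setT t & pi t = s)).
- by exists 1; [constructor | exact: gmulf1].
- move=> s t [u Su <-] [v Sv <-].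
  by exists (u * v); [exact: spanM | exact: piM].
- by move=> a b c _ _ _ D; exists (Z a b c); [apply: span_gen | apply: Zpi].
- by apply/fintype.subsetP => u; rewrite inE.
- exact: pi_even.
Qed.

Lemma spanV S x : span S x -> span S x^-1.
Proof.
elim=> [|y a b c _ IH aS bS cS D|y _ IH]; first by rewrite invg1; constructor.
  rewrite invgM ZV //; apply: spanM IH.
  by apply: span_gen => //; apply: distinct3_rev.
rewrite invgM (mulg1_eq delta2); apply: spanM IH; exact: span_delta1.
Qed.

Lemma derived_span x : derived setT x -> span finset.setT x.
Proof.
elim/derived_ind_mul => [|y z Sy Sz|y z _ _]; first by constructor.
  exact: spanM.
have [u Su uy] := span_lift y; have [v Sv vz] := span_lift z.
have [u' cu ->] := fiber_central pi_central (esym uy).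
have [v' cv ->] := fiber_central pi_central (esym vz).
rewrite commg_centralM // commgEl conjgE.
by apply: spanM; [|apply: spanM; [|apply: spanM]] => //; apply: spanV.
Qed.

End Span.

Lemma alternating_derived (K : groupType) (phi : {hom E -> K}) :
  commutativity_preserving phi -> (forall x, phi x = 1 -> pi x = 1) ->
  forall x, derived setT x -> phi x = 1 -> x = 1.
Proof.
move=> phiCP phi_pi x Dx x1; have [Z ZP] := cycle_lifts_exist.
have [delta [cdelta klein]] := klein_const ZP.
have Sx : span Z delta finset.setT x by apply: derived_span.
have [//|xd] : x = 1 \/ x = delta by apply: (span_kernel ZP _ _ Sx); auto.
have phid : phi delta = 1 by rewrite -xd.
rewrite xd; exact: (delta_kernel ZP cdelta klein phiCP phid).
Qed.

End Lifts.

(** * Perfect groups and their Schur multiplier *)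

Section ChainComplex.
Local Open Scope ring_scope.

Lemma chain_basis_sum (X : finType) (c : {ffun X -> int}) :
  c = \sum_x chain_basis x *~ c x.
Proof.
apply/ffunP => y; rewrite sum_ffunE (bigD1 y) //=.
rewrite big1 ?addr0 => [|x /negPf xy].
  by rewrite ffunMzE ffunE eqxx intz.
by rewrite ffunMzE ffunE eq_sym xy mul0rz.
Qed.

Lemma additive_basis_eq0 (X : finType) (V : zmodType)
    (F : {additive {ffun X -> int} -> V}) :
  (forall x, F (chain_basis x) = 0) -> forall c, F c = 0.
Proof.
move=> F0 c; rewrite [c]chain_basis_sum raddf_sum big1 // => x _.
by rewrite raddfMz /= F0 mul0rz.
Qed.

Variable G : finGroupType.

Lemma boundary2_basis (x y : G) : boundary2 G (chain_basis (x, y)) =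
  chain_basis y - chain_basis (x * y)%g + chain_basis x.
Proof. exact: linear_ext_basis. Qed.

Lemma boundary3_basis (x y z : G) : boundary3 G (chain_basis (x, y, z)) =
  chain_basis (y, z) - chain_basis ((x * y)%g, z)
  + chain_basis (x, (y * z)%g) - chain_basis (x, y).
Proof. exact: linear_ext_basis. Qed.

(** The first homology group of [G] is its abelianization, hence vanishes:
    modulo boundaries [chain_basis] is a homomorphism to an abelian group, so
    it kills commutators. *)
Lemma perfect_boundary2 : [set: G]^`(1)%g = [set: G]%g ->
  forall x : G, exists c, boundary2 G c = chain_basis x.
Proof.
move=> perfG x.
pose B := [set y : G | `[< exists c, boundary2 G c = chain_basis y >]]%g.
have BP y : y \in B <-> exists c, boundary2 G c = chain_basis y.
  by rewrite inE; split=> [/asboolP|?]; last apply/asboolP.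
have gB : group_set B.
  apply/group_setP; split=> [|y z /BP[c cy] /BP[d dz]]; apply/BP.
    exists (chain_basis (1%g, 1%g)).
    by rewrite boundary2_basis mulg1 subrr add0r.
  exists (d + c - chain_basis (y, z)).
  rewrite raddfB raddfD /= cy dz boundary2_basis.
  by rewrite !opprD !opprK !addrA [LHS](ACl (4*(1*3)*(2*5))) /= !subrr !addr0.
have : x \in [set: G]^`(1)%g by rewrite perfG inE.
suff /fintype.subsetP BG : [set: G]^`(1)%g \subset Group gB.
  by move/BG/BP.
rewrite gen_subG; apply/fintype.subsetP => _ /imset2P[y z _ _ ->].
apply/BP; exists (chain_basis ((z * y)%g, [~ y, z]%g) - chain_basis (y, z)
  + chain_basis (z, y)).
rewrite raddfD raddfB /= !boundary2_basis -commgC.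
rewrite !opprD !opprK !addrA.
rewrite [LHS](ACl (1*(2*5)*(3*8)*(4*9)*(6*7))) /=.
by rewrite !addNr !subrr !addr0.
Qed.
End ChainComplex.

Section KernelModule.
Variables (F G : groupType) (pi : {hom F -> G}).
Hypothesis pi_central : forall z, pi z = 1 -> central z.

(** The central subgroup [ker pi], written additively so that [linear_ext] can
    extend a cocycle with values in it to chains. *)
Definition kernel_of (_ : forall z, pi z = 1 -> central z) : Type :=
  {x : F | pi x == 1}.
Local Notation kernel := (kernel_of pi_central).
HB.instance Definition _ := SubChoice.on kernel.

Lemma kernelP (u : kernel) : pi (val u) = 1.
Proof. exact/eqP/(valP u). Qed.

Lemma kernel_central (u : kernel) : central (val u).
Proof. exact/pi_central/kernelP. Qed.

Definition to_kernel x (x1 : pi x = 1) : kernel := exist _ x (introT eqP x1).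

Lemma kernel_add_subproof (u v : kernel) : pi (val u * val v) = 1.
Proof. by rewrite gmulfM !kernelP mulg1. Qed.
Lemma kernel_opp_subproof (u : kernel) : pi (val u)^-1 = 1.
Proof. by rewrite gmulfV kernelP invg1. Qed.

Definition kernel_add (u v : kernel) := to_kernel (kernel_add_subproof u v).
Definition kernel_opp (u : kernel) := to_kernel (kernel_opp_subproof u).
Definition kernel0 : kernel := to_kernel (gmulf1 : pi 1 = 1).

Lemma kernel_addA : associative kernel_add.
Proof. by move=> u v w; apply/val_inj; rewrite /= mulgA. Qed.
Lemma kernel_addC : commutative kernel_add.
Proof. by move=> u v; apply/val_inj/kernel_central. Qed.
Lemma kernel_add0 : left_id kernel0 kernel_add.
Proof. by move=> u; apply/val_inj; rewrite /= mul1g. Qed.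
Lemma kernel_addN : left_inverse kernel0 kernel_opp kernel_add.
Proof. by move=> u; apply/val_inj; rewrite /= mulVg. Qed.
HB.instance Definition _ := GRing.isZmodule.Build kernel
  kernel_addA kernel_addC kernel_add0 kernel_addN.

Lemma val_kernelD (u v : kernel) : val (u + v)%R = val u * val v.
Proof. by []. Qed.
End KernelModule.

Section CentralExtension.
Variables (F : groupType) (G : finGroupType) (pi : {hom F -> G}).
Hypothesis pi_surj : forall g, exists x, pi x = g.
Hypothesis pi_central : forall z, pi z = 1 -> central z.
Hypothesis perfG : [set: G]^`(1) = [set: G].

Lemma perfect_lift g : exists l, derived setT l /\ pi l = g.
Proof.
pose B := [set y : G | `[< exists l, derived setT l /\ pi l = y >]]%g.
have BP y : y \in B <-> exists l, derived setT l /\ pi l = y.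
  by rewrite inE; split=> [/asboolP|?]; last apply/asboolP.
have gB : group_set B.
  apply/group_setP; split=> [|y z /BP[k [Dk <-]] /BP[l [Dl <-]]]; apply/BP.
    by exists 1; split; [exact: derived1 | exact: gmulf1].
  by exists (k * l); split; [exact: derivedM | exact: gmulfM].
have : g \in [set: G]^`(1)%g by rewrite perfG inE.
suff /fintype.subsetP BG : [set: G]^`(1)%g \subset Group gB.
  by move/BG/BP.
rewrite gen_subG; apply/fintype.subsetP => _ /imset2P[y z _ _ ->].
apply/BP; have [y' <-] := pi_surj y; have [z' <-] := pi_surj z.
by exists [~ y', z']; split; [exact: derived_comm | exact: gmulfR].
Qed.

(** Modulo central elements every element of [F] lies in the derived subgroup,
    and central factors do not affect commutators. *)
Lemma derived_perfect (x : F) : derived setT x -> derived (derived setT) x.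
Proof.
have dec (y : F) : exists (l z : F), [/\ derived setT l, central z & y = l * z].
  have [l [Dl ly]] := perfect_lift (pi y).
  by have [z cz yE] := fiber_central pi_central (esym ly); exists l, z.
elim/derived_ind_mul => [|y z Dy Dz|y z _ _]; first exact: derived1.
  exact: derivedM.
have [k [u [Dk cu ->]]] := dec y; have [l [v [Dl cv ->]]] := dec z.
by rewrite commg_centralM //; apply: derived_comm.
Qed.

(** The cocycle [f0] of a section [s] extends to a map [f] on 2-chains.  As [G]
    is perfect, each [chain_basis x] is the boundary of a chain [c x]; the
    section [t x := s x * (f (c x))^-1] is then multiplicative up to values of
    [f] on cycles.  So these values together with the elements [t x] form a
    subgroup, which contains all commutators. *)
Lemma schur_multiplier_onto :
  exists f : {additive {ffun G * G -> int} -> kernel_of pi_central},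
    (forall c, f (boundary3 G c) = 0%R) /\
    forall e, derived setT e -> pi e = 1 ->
      exists2 z, boundary2 G z = 0%R & val (f z) = e.
Proof.
have [s sK] := choice pi_surj.
have fP x y : pi (s x * s y * (s (x * y))^-1) = 1.
  by rewrite !gmulfM gmulfV !sK mulgV.
pose f0 (p : G * G) : kernel_of pi_central := to_kernel pi_central (fP p.1 p.2).
have f0E x y : s x * s y = val (f0 (x, y)) * s (x * y) by rewrite /= mulgVK.
pose f : {additive {ffun G * G -> int} -> kernel_of pi_central} :=
  linear_ext f0.
have fE p : f (chain_basis p) = f0 p by apply: linear_ext_basis.
exists f; split.
  apply: (@additive_basis_eq0 _ _ (f \o boundary3 G)%FUN) => -[[x y] z].
  rewrite /= boundary3_basis raddfB raddfD raddfB /= !fE.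
  apply/eqP; rewrite subr_eq0 addrAC subr_eq; apply/eqP/val_inj.
  apply: (@mulIg _ (s (x * y * z))).
  rewrite !val_kernelD; transitivity (s x * s y * s z).
    rewrite -(mulgA x y z) -mulgA -(f0E x) (mulgA (val (f0 (y, z)))).
    by rewrite (kernel_central (f0 (y, z))) -mulgA -f0E mulgA.
  by rewrite -[RHS]mulgA -f0E mulgA -f0E.
have kerf c : pi (val (f c)) = 1 by apply: kernelP.
have [c cE] := choice (perfect_boundary2 perfG).
pose B b := exists2 z, boundary2 G z = 0%R & val (f z) = b.
have BM a b : B a -> B b -> B (a * b).
  move=> [z z0 <-] [t t0 <-]; exists (z + t)%R; last by rewrite raddfD.
  by rewrite raddfD /= z0 t0 addr0.
have BV a : B a -> B a^-1.
  move=> [z z0 <-]; exists (- z)%R; last by rewrite raddfN.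
  by rewrite raddfN /= z0 oppr0.
have Bc b : B b -> central b by move=> [z _ <-]; apply: kernel_central.
pose t x := s x * (val (f (c x)))^-1.
have tM x y : exists2 b, B b & t x * t y = t (x * y) * b.
  pose z := (chain_basis (x, y) - c x - c y + c (x * y)%g)%R.
  exists (val (f z)).
    exists z => //; rewrite raddfD !raddfB /= !cE boundary2_basis.
    by rewrite [LHS](ACl ((1*5)*(2*6)*(3*4))) /= !subrr addNr !addr0.
  rewrite /z raddfD !raddfB /= fE /t.
  pose u := val (f (c x)); pose v := val (f (c y)).
  pose w := val (f (c (x * y))).
  pose q := val (f0 (x, y)) * u^-1 * v^-1.
  have cq : central q.
    apply: centralM; last exact/centralV/kernel_central.
    by apply: centralM; [|apply: centralV]; apply: kernel_central.
  change (s x * u^-1 * (s y * v^-1) = s (x * y) * w^-1 * (q * w)).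
  rewrite -(mulgA (s (x * y))) (mulgA w^-1) -(commuteV (cq w)) mulgVK.
  rewrite -(cq (s (x * y))) -mulgA (mulgA u^-1).
  rewrite (centralV (kernel_central _) (s y)) -(mulgA (s y)) mulgA f0E.
  rewrite /q -!mulgA.
  congr (_ * (_ * (_ * _))); rewrite [RHS]mulgA; apply/commute_sym.
  by apply: centralM; apply/centralV/kernel_central.
have Bt1 : B (t 1).
  by have [b Bb] := tM 1 1; rewrite mulg1 => /mulgI ->.
pose S e := exists x b, B b /\ e = t x * b.
have tS x b : B b -> S (t x * b) by exists x, b.
have SM d e : S d -> S e -> S (d * e).
  move=> [x [a [Ba ->]]] [y [b [Bb ->]]]; have [d' Bd tE] := tM x y.
  rewrite -(mulgA (t x)) (mulgA a) (Bc _ Ba) -(mulgA (t y)) (mulgA (t x)) tE.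
  rewrite -mulgA; apply: tS; apply: (BM); first exact: Bd.
  exact: BM Ba Bb.
have dec y : exists z, central z /\ y = t (pi y) * z.
  have piE : pi y = pi (t (pi y)).
    by rewrite gmulfM gmulfV sK kerf [RHS]divg1.
  by have [z cz yE] := fiber_central pi_central piE; exists z.
move=> e De e1; suff [x [b [[z z0 fz] eE]]] : S e.
  have [z' z'0 fz'] := Bt1.
  have x1 : x = 1.
    have := congr1 pi eE; rewrite e1 !gmulfM gmulfV sK -fz !kerf.
    by rewrite mulg1 [RHS]divg1.
  exists (z' + z)%R; first by rewrite raddfD /= z0 z'0 addr0.
  by rewrite eE x1 -fz' -fz raddfD.
elim/derived_ind_mul: De => // [|y z _ _].
  by exists 1, (t 1)^-1; rewrite mulgV; split => //; apply: BV.
have [u [cu ->]] := dec y; have [v [cv ->]] := dec z.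
rewrite commg_centralM //; set g := pi y; set h := pi z.
have [b1 Bb1 E1] := tM g h; have [b2 Bb2 E2] := tM h g.
have [b3 Bb3 E3] := tM (h * g) [~ g, h].
rewrite -commgC in E3.
have -> : [~ t g, t h] = t [~ g, h] * (b3^-1 * b1 * b2^-1).
  apply: (mulgI (t h * t g)); rewrite -commgC E1 E2.
  rewrite -[RHS]mulgA (Bc _ Bb2) -(mulgA (t [~ g, h])) mulgVK [RHS]mulgA E3.
  by rewrite -[RHS]mulgA mulVKg.
by apply: tS; apply: (BM); [apply: (BM); [apply: (BV)|] | apply: (BV)].
Qed.

(** By [schur_multiplier_onto], the Schur multiplier maps onto the intersection
    of the derived subgroup and the kernel. *)
Lemma schur_multiplier_kernel :
  (forall x : schur_multiplier G, x = 0%R)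
    \/ zmod_isomorphic (schur_multiplier G) 'Z_2 ->
  forall a b, derived setT a -> derived setT b -> pi a = 1 -> pi b = 1 ->
    a <> 1 -> b <> 1 -> a = b.
Proof.
have [f [f3 fP]] := schur_multiplier_onto.
pose cyc c (c0 : boundary2 G c = 0%R) : cycles (boundary2 G) :=
  exist _ c (introT eqP c0).
pose cl c c0 : schur_multiplier G := (\pi_(homology _ _) (cyc c c0))%qT.
have clE c c0 d d0 : cl c c0 = cl d d0 -> f c = f d.
  move=> /eqP; rewrite -Quotient.idealrBE => /asboolP[x /= xE].
  by apply/eqP; rewrite -subr_eq0 -raddfB -xE f3.
have cl0 c c0 : cl c c0 = 0%R -> f c = 0%R.
  have b0 : boundary2 G 0%R = 0%R by rewrite raddf0.
  rewrite -(raddf0 f) => cE; apply: (clE c c0 0%R b0); rewrite cE /cl.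
  rewrite -(raddf0 \pi_(homology (boundary3 G) (boundary2 G))%qT).
  by congr (\pi _)%qT; apply/val_inj.
move=> H a b Da Db a1 b1 a_neq b_neq.
have [c c0 ca] := fP a Da a1; have [d d0 db] := fP b Db b1.
have clc : cl c c0 <> 0%R by move/cl0 => fc; apply: a_neq; rewrite -ca fc.
have cld : cl d d0 <> 0%R by move/cl0 => fd; apply: b_neq; rewrite -db fd.
case: H => [H0|[g [g' gK _]]]; first by case: clc.
rewrite -ca -db (clE c c0 d d0) //; apply: (can_inj gK).
have g_neq0 x : x <> 0%R -> g x != 0%R.
  move=> x0; apply/eqP => gx; apply: x0.
  by apply: (can_inj gK); rewrite gx raddf0.
move: (g_neq0 _ clc) (g_neq0 _ cld).
case: (g _) => [[|[|//]] i]; case: (g _) => [[|[|//]] j] // _ _.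
exact/val_inj.
Qed.
End CentralExtension.

(** * Lifting automorphisms to perfect central extensions *)

(** Maps that agree up to central factors agree on commutators. *)
Lemma perfect_hom_unique (E F : groupType) (D : E -> Prop) (f g : E -> F) :
  (forall x, D x -> derived D x) ->
  (forall x y, D x -> D y -> D (x * y)) -> (forall x, D x -> D x^-1) ->
  (forall x y, D x -> D y -> f (x * y) = f x * f y) ->
  (forall x y, D x -> D y -> g (x * y) = g x * g y) ->
  (forall x, D x -> exists2 z, central z & f x = g x * z) ->
  forall x, D x -> f x = g x.
Proof.
move=> perfD DM DV fM gM fg x Dx.
have D1 : D 1 by rewrite -(mulgV x); apply: (DM) => //; apply: (DV).
have hR (h : E -> F) : (forall x y, D x -> D y -> h (x * y) = h x * h y) ->
    h 1 = 1 /\ forall y z, D y -> D z -> h [~ y, z] = [~ h y, h z].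
  move=> hM; have h1 : h 1 = 1 by apply: (mulgI (h 1)); rewrite -hM // !mulg1.
  have hV y : D y -> h y^-1 = (h y)^-1.
    by move=> Dy; apply/esym/mulg1_eq; rewrite -hM ?mulgV //; apply: (DV).
  split=> // y z Dy Dz; have [DVy DVz] := (DV y Dy, DV z Dz).
  by rewrite !commgEl !conjgE !hM ?hV //; do ?[apply: (DM) => //].
have [f1 fR] := hR f fM; have [g1 gR] := hR g gM.
have DR y z : D y -> D z -> D [~ y, z].
  by move=> Dy Dz; do ![apply: (DM); do ?[apply: (DV)]].
suff [] : D x /\ f x = g x by [].
elim: (perfD x Dx) => [|u y z _ [Du fu] Dy Dz]; first by rewrite f1 g1.
split; first by apply: (DM) => //; apply: (DR).
have Dyz := DR y z Dy Dz.
rewrite (fM u _ Du Dyz) (gM u _ Du Dyz) fu (fR _ _ Dy Dz) (gR _ _ Dy Dz).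
congr (_ * _).
have [v cv ->] := fg y Dy; have [w cw ->] := fg z Dz.
exact: commg_centralM.
Qed.

Section FibreProduct.
Variables (F : groupType) (G : finGroupType) (pi : {hom F -> G}).
Variables (alpha : G -> G) (alphaM : {morph alpha : x y / x * y}).

Definition fibre_product (_ : {morph alpha : x y / x * y}) : {pred F * F} :=
  fun p => alpha (pi p.1) == pi p.2.

Lemma fibre_product_closed : group_closed (fibre_product alphaM).
Proof.
split=> [|p q]; rewrite !unfold_in /=.
  by rewrite !gmulf1 (mul_morph1 alphaM).
move=> /eqP Pp /eqP Pq.
by rewrite !gmulfF alphaM (mul_morphV alphaM) Pp Pq.
Qed.
HB.instance Definition _ := monoid.isMulClosed.Build _ (fibre_product alphaM)
  (group_closedM fibre_product_closed).
HB.instance Definition _ := monoid.isMul1Closed.Build _ (fibre_product alphaM)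
  fibre_product_closed.1.
HB.instance Definition _ := isInvClosed.Build _ (fibre_product alphaM)
  (group_closedV fibre_product_closed).

Definition fibre_group : groupType :=
  subgroup (fibre_product alphaM : groupClosed (F * F)%type).

Definition fibre_fst (p : fibre_group) : F := (val p).1.
Definition fibre_snd (p : fibre_group) : F := (val p).2.
Lemma fibre_fst_morphism : monoid.monoid_morphism fibre_fst.
Proof. by []. Qed.
Lemma fibre_snd_morphism : monoid.monoid_morphism fibre_snd.
Proof. by []. Qed.
HB.instance Definition _ := isUMagmaMorphism.Build fibre_group F fibre_fst
  fibre_fst_morphism.
HB.instance Definition _ := isUMagmaMorphism.Build fibre_group F fibre_snd
  fibre_snd_morphism.

Lemma fibreP (p : fibre_group) : alpha (pi (fibre_fst p)) = pi (fibre_snd p).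
Proof. exact/eqP/(valP p). Qed.

Lemma fibre_exists x y : alpha (pi x) = pi y ->
  exists p, fibre_fst p = x /\ fibre_snd p = y.
Proof.
move=> xy; have Pxy : (x, y) \in fibre_product alphaM by apply/eqP.
by exists (exist _ (x, y) Pxy).
Qed.

Hypothesis pi_surj : forall g, exists x, pi x = g.
Hypothesis pi_central : forall z, pi z = 1 -> central z.
Hypothesis perfG : [set: G]^`(1) = [set: G].
Hypothesis schurG : (forall x : schur_multiplier G, x = 0%R)
    \/ zmod_isomorphic (schur_multiplier G) 'Z_2.

Let graph (x y : F) := exists p : fibre_group,
  [/\ derived setT p, fibre_fst p = x & fibre_snd p = y].

(** The derived subgroup of the fibre product is the graph of the lift.  It
    projects onto the derived subgroup on the first factor; if it contained
    [(1, y)] with [y <> 1], it would also contain some [(y, w)] over the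
    identity, whereas by [schur_multiplier_kernel] it has at most one
    nontrivial element there. *)
Lemma perfect_extension_lift :
  exists t : F -> F,
    [/\ forall x, derived setT x -> derived setT (t x),
        forall x, derived setT x -> pi (t x) = alpha (pi x)
      & forall x y, derived setT x -> derived setT y -> t (x * y) = t x * t y].
Proof.
have graphM x y x' y' : graph x y -> graph x' y' -> graph (x * x') (y * y').
  move=> [p [Dp <- <-]] [q [Dq <- <-]]; exists (p * q).
  by split; [exact: derivedM|..]; rewrite gmulfM.
have graphV x y : graph x y -> graph x^-1 y^-1.
  move=> [p [Dp <- <-]]; exists p^-1.
  by split; [exact: derivedV|..]; rewrite gmulfV.
have tot x : exists y, derived setT x -> graph x y.
  case: (pselect (derived setT x)) => [Dx|]; last by exists 1.
  suff [y gxy] : exists y, graph x y by exists y.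
  elim/derived_ind_mul: Dx => [|u v [u' Hu] [v' Hv]|u v _ _].
  - by exists 1, 1; split; [exact: derived1|..]; exact: gmulf1.
  - by exists (u' * v'); apply: graphM.
  have lft w : exists p, fibre_fst p = w.
    have [w' w'E] := pi_surj (alpha (pi w)).
    by have [p [pw _]] := fibre_exists (esym w'E); exists p.
  have [p <-] := lft u; have [q <-] := lft v.
  exists (fibre_snd [~ p, q]), [~ p, q].
  by split; [exact: derived_comm|exact: gmulfR|].
have graphD x y : graph x y -> derived setT y.
  by move=> [p [Dp _ <-]]; apply: derived_morph Dp.
have graph1 y : graph 1 y -> y = 1.
  move=> g1y; apply: contrapT => y_neq1.
  have Dy := graphD _ _ g1y.
  have [p [Dp p1 py]] := g1y.
  have y1 : pi y = 1.
    by rewrite -py -fibreP p1 gmulf1 (mul_morph1 alphaM).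
  have [w /(_ Dy) [q [Dq qy qw]]] := tot y.
  pose piP : {hom fibre_group -> G} := (pi \o fibre_fst)%FUN.
  have w1 : pi w = 1.
    by rewrite -qw -fibreP qy y1 (mul_morph1 alphaM).
  suff pq : p = q by apply: y_neq1; rewrite -qy -pq p1.
  apply: (@schur_multiplier_kernel fibre_group G piP) => //.
  - move=> g; have [x xg] := pi_surj g; have [x' x'E] := pi_surj (alpha (pi x)).
    have [r [rx _]] := fibre_exists (esym x'E).
    by exists r; rewrite /piP /= rx.
  - move=> r; rewrite /piP /= => r1 s.
    have r2 : pi (fibre_snd r) = 1.
      by rewrite -fibreP r1 (mul_morph1 alphaM).
    apply/val_inj/injective_projections.
      exact: (pi_central r1 (fibre_fst s)).
    exact: (pi_central r2 (fibre_snd s)).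
  - by rewrite /piP /= p1 gmulf1.
  - by rewrite /piP /= qy.
  - by move=> p_1; apply: y_neq1; rewrite -py p_1 gmulf1.
  - by move=> q_1; apply: y_neq1; rewrite -qy q_1 gmulf1.
have graph_fun x y y' : graph x y -> graph x y' -> y = y'.
  move=> gy /graphV gy'; have := graphM _ _ _ _ gy gy'.
  by rewrite mulgV => /graph1/divg1_eq.
have [t tP] := choice tot; exists t; split=> [x Dx|x Dx|x y Dx Dy].
- exact: graphD (tP x Dx).
- by have [p [_ <- <-]] := tP x Dx; rewrite fibreP.
- by apply: graph_fun (graphM _ _ _ _ (tP x Dx) (tP y Dy)); apply/tP/derivedM.
Qed.

End FibreProduct.

(** * The three families of groups *)

Section TensorOfPerfect.
Variables (G : finGroupType) (H : groupType).
Variables (actG : G -> H -> H) (actH : H -> G -> G).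
Hypotheses (actGP : left_action_by_aut actG) (actHP : left_action_by_aut actH).
Hypothesis compat : compatible_actions actG actH.
Variables (E : groupType) (phi : {hom E -> tensor actG actH}).
Variable lambda : {hom tensor actG actH -> G}.
Hypothesis lambdaE :
  forall g h, lambda (tens actG actH g h) = g * (actH h g)^-1.

Hypothesis pi_surj : forall g, exists x, lambda (phi x) = g.
Hypothesis pi_central : forall z, lambda (phi z) = 1 -> central z.
Hypothesis perfG : [set: G]^`(1) = [set: G].
Hypothesis schurG : (forall x : schur_multiplier G, x = 0%R)
    \/ zmod_isomorphic (schur_multiplier G) 'Z_2.

(** With [t h] the lift to [D] of the action of [h], the map [th h l] only
    depends on the image of [l] in [G], and the identities that make
    [(g, h) |-> th h (s g)] respect the relations of the tensor product hold
    modulo the kernel by compatibility, hence hold by uniqueness of lifts. *)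
Lemma perfect_tensor_derived x : derived setT x -> phi x = 1 -> x = 1.
Proof.
pose pi : {hom E -> G} := (lambda \o phi)%FUN.
have piM y z : pi (y * z) = pi y * pi z by exact: gmulfM.
have piV y : pi y^-1 = (pi y)^-1 by exact: gmulfV.
pose D : E -> Prop := derived setT.
have perfD y : D y -> derived D y by apply: (derived_perfect (pi := pi)).
have DM y z : D y -> D z -> D (y * z) by apply: derivedM.
have DV y : D y -> D y^-1 by apply: derivedV.
have DJ y z : D y -> D (z * y * z^-1).
  by move/(derivedJ z^-1); rewrite conjgE invgK mulgA.
have fib (y z : E) : pi y = pi z -> exists2 c, central c & y = z * c.
  exact: fiber_central.
have uniq (f g : E -> E) :
    (forall y z, D y -> D z -> f (y * z) = f y * f z) ->
    (forall y z, D y -> D z -> g (y * z) = g y * g z) ->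
    (forall y, D y -> pi (f y) = pi (g y)) -> forall y, D y -> f y = g y.
  move=> fM gM fg; apply: (perfect_hom_unique perfD) => // y Dy.
  exact/fib/fg.
have lift h := @perfect_extension_lift E G pi (actH h)
  (left_act_morph actHP h) pi_surj pi_central perfG schurG.
have [t tP] := choice lift.
have tD h y : D y -> D (t h y) by case: (tP h) => + _ _; apply.
have tpi h y : D y -> pi (t h y) = actH h (pi y).
  by case: (tP h) => _ + _; apply.
have tM h y z : D y -> D z -> t h (y * z) = t h y * t h z.
  by case: (tP h) => _ _; apply.
have D1 : D 1 by exact: derived1.
have t1 h : t h 1 = 1 by apply: (mulgI (t h 1)); rewrite -tM // !mulg1.
have tact h h' y : D y -> t (h * h') y = t h (t h' y).
  move: y; apply: uniq => [y z Dy Dz|y z Dy Dz|y Dy].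
  - exact: tM.
  - by rewrite !tM //; apply: (tD).
  - by rewrite !tpi ?(left_actM actHP) //; apply: (tD).
have tid y : D y -> t 1 y = y.
  move: y; apply: (uniq (t 1) id) => [y z|//|y Dy]; first exact: tM.
  by rewrite tpi // (left_act1 actHP).
(* An automorphism of a group with at most two elements is trivial. *)
have tker h a : D a -> pi a = 1 -> t h a = a.
  move=> Da a1; case: (pselect (a = 1)) => [->|a_neq1]; first exact: t1.
  apply: (schur_multiplier_kernel (pi := pi)) => //.
  - exact: (tD).
  - by rewrite tpi // a1 (act1 actHP).
  by move=> ta; apply: a_neq1; rewrite -(tid a Da) -(mulVg h) tact // ta t1.
pose th h l := l * (t h l)^-1.
have th_fib h l l' : D l -> D l' -> pi l = pi l' -> th h l = th h l'.
  move=> Dl Dl' ll'; pose a := l'^-1 * l.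
  have Da : D a by apply: (DM) => //; apply: (DV).
  have a1 : pi a = 1 by rewrite /a piM piV ll' mulVg.
  have -> : l = l' * a by rewrite mulVKg.
  by rewrite /th tM // (tker h a) // invgM mulgA mulgK.
have [s sP] := choice (perfect_lift (pi := pi) pi_surj perfG).
have thE h g l : D l -> pi l = g -> th h (s g) = th h l.
  by move=> Dl lg; have [Ds sg] := sP g; apply: th_fib => //; rewrite sg.
have [Theta ThetaE] : exists f : {hom tensor actG actH -> E},
    forall g h, f (tens actG actH g h) = th h (s g).
  apply: tensor_hom => [g g' h|g h h'].
    have [[Dl lg] [Dl' lg']] := (sP g, sP g').
    set l := s g in Dl lg *; set l' := s g' in Dl' lg' *.
    rewrite (thE h (g * g') (l * l')); first last.
    - by rewrite piM lg lg'.
    - exact: DM.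
    rewrite (thE _ (g * g' * g^-1) (l * l' * l^-1)); first last.
    - by rewrite !piM piV lg lg'.
    - exact: DJ.
    have tJ y : D y -> t (actG g h) (l * y * l^-1) = l * t h y * l^-1.
      move: y; apply: (uniq (fun y => t (actG g h) (l * y * l^-1))
        (fun y => l * t h y * l^-1)) => [y z Dy Dz|y z Dy Dz|y Dy].
      - by rewrite -tM; do ?exact: DJ; rewrite !mulgA mulgVK.
      - by rewrite tM // !mulgA mulgVK.
      - rewrite tpi; last exact: DJ.
        rewrite !piM piV lg tpi //.
        exact: (compatG compat).
    rewrite /th tJ // tM // !invgM invgK !mulgA.
    by rewrite !mulgVK.
  have [Dl lg] := sP g; set l := s g in Dl lg *.
  rewrite (thE _ (actH h g) (t h l)); first last.
  - by rewrite tpi // lg.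
  - exact: tD.
  by rewrite /th -tact // mulgVK mulgA mulgVK.
have piTheta k : pi (Theta k) = lambda k.
  have gen g h : pi (Theta (tens actG actH g h)) = lambda (tens actG actH g h).
    have [Ds sg] := sP g.
    by rewrite ThetaE lambdaE /th piM piV tpi // sg.
  elim/tensor_ind: k => [|g h u IH|g h u IH]; first by rewrite !gmulf1.
    by rewrite [in LHS]gmulfM [in LHS]gmulfM gen IH gmulfM.
  by rewrite [in LHS]gmulfM [in LHS]gmulfM 2!gmulfV gen IH gmulfM gmulfV.
move=> Dx x1; rewrite -[LHS](uniq (fun y => Theta (phi y)) id _ _ _ x Dx).
- by rewrite x1 gmulf1.
- by move=> y z _ _; rewrite !gmulfM.
- by [].
- by move=> y _; rewrite piTheta.
Qed.

End TensorOfPerfect.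

Section Cases.
Variables (G : finGroupType) (H : groupType).
Variables (actG : G -> H -> H) (actH : H -> G -> G).
Hypotheses (actGP : left_action_by_aut actG) (actHP : left_action_by_aut actH).
Hypothesis compat : compatible_actions actG actH.
Variable lambda : {hom tensor actG actH -> G}.
Hypothesis lambdaE :
  forall g h, lambda (tens actG actH g h) = g * (actH h g)^-1.
Variables (E : groupType) (phi : {hom E -> tensor actG actH}).
Hypothesis phi_surj : forall k, exists x, phi x = k.
Hypothesis phiCP : commutativity_preserving phi.

Let pi : {hom E -> G} := (lambda \o phi)%FUN.

Lemma lambda_phi_central z : pi z = 1 -> central z.
Proof.
move=> z1 y; apply/commgP/eqP/phiCP; rewrite gmulfR; apply/eqP/commgP.
exact: (tensor_lambda_central actGP actHP compat lambdaE z1).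
Qed.

Lemma lambda_image : exists D : {group G},
  [/\ D <| [set: G], forall x, pi x \in D
    & forall d, d \in D -> exists x, pi x = d].
Proof.
pose D := [set g : G | `[< exists x, pi x = g >]]%g.
have DP g : g \in D <-> exists x, pi x = g.
  by rewrite inE; split=> [/asboolP|?]; last apply/asboolP.
have gD : group_set D.
  apply/group_setP; split=> [|g h /DP[x <-] /DP[y <-]]; apply/DP.
    by exists 1; apply: gmulf1.
  by exists (x * y); apply: gmulfM.
exists (Group gD); split=> [|x|d]; [|by apply/DP; exists x|by move/DP].
apply/andP; split; first exact: finset.subsetT.
apply/fintype.subsetP => g _; rewrite inE.
apply/fintype.subsetP => _ /imsetP[d /DP[x <-] ->].
have [k kE] := tensor_lambda_normal compat lambdaE g^-1 (phi x).
have [y yk] := phi_surj k; apply/DP; exists y.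
by rewrite /pi /= yk kE conjgE invgK mulgA.
Qed.

Lemma metacyclic_case : metacyclic [set: G] ->
  forall x, derived setT x -> phi x = 1 -> x = 1.
Proof.
move=> mG; have [D [_ piD Dpi]] := lambda_image.
apply: (metacyclic_derived phiCP lambda_phi_central piD Dpi).
exact: metacyclicS (finset.subsetT _) mG.
Qed.

Lemma trivial_case : (forall x, pi x = 1) ->
  forall x, derived setT x -> phi x = 1 -> x = 1.
Proof.
move=> pi1 x Dx _; elim/derived_ind_mul: Dx => [|y z -> ->|y z _ _] //.
  exact: mulg1.
exact/eqP/commgP/(lambda_phi_central (pi1 y)).
Qed.

Lemma simple_case : simple [set: G] ->
  (forall x : schur_multiplier G, x = 0%R)
    \/ zmod_isomorphic (schur_multiplier G) 'Z_2 ->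
  forall x, derived setT x -> phi x = 1 -> x = 1.
Proof.
move=> simG schurG; have [D [nD piD Dpi]] := lambda_image.
have [abG|nabG] := boolP (abelian [set: G]).
  apply: metacyclic_case; apply/cyclic_metacyclic/prime_cyclic.
  exact: simple_sol_prime (abelian_sol abG) simG.
have [_ simP] := simpleP _ simG.
have [D1|DT] := simP D nD.
  by apply: trivial_case => x; apply/set1gP; rewrite -D1.
apply: (perfect_tensor_derived actHP compat lambdaE) => //.
- by move=> g; apply: Dpi; rewrite DT inE.
- exact: lambda_phi_central.
have [G1|//] := simP [set: G]^`(1)%G (der_normal 1 _).
by case/negP: nabG; rewrite (sameP derG1P eqP) G1.
Qed.

(** Automorphisms of the symmetric group preserve parity, so [lambda], whose
    values are products of elements [g * (actH h g)^-1] and their inverses, only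
    takes even values. *)
Lemma symmetric_case n : n = 5 \/ 8 <= n -> [set: G] \isog [set: 'S_n] ->
  forall x, derived setT x -> phi x = 1 -> x = 1.
Proof.
move=> n58 /isogP[f injf imf].
have fM g h : f (g * h) = f g * f h by rewrite morphM ?inE.
have fV g : f g^-1 = (f g)^-1 by rewrite morphV ?inE.
have f1 : f 1 = 1 by rewrite morph1.
have finj : injective f by move=> g h; apply: (injmP injf); rewrite inE.
have fsurj s : exists g, f g = s.
  have : s \in f @* [set: G] by rewrite imf inE.
  by case/morphimP => g _ _ ->; exists g.
have [fi fiK] := choice fsurj.
have fK g : fi (f g) = g by apply: finj.
have act_even h g : f g = false :> bool -> f (actH h g) = false :> bool.
  move=> evg; rewrite -(fK g).
  apply: (even_endomorphism (alpha := fun s => f (actH h (fi s)))) => // s t.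
  rewrite -fM -(actM actHP); congr (f (actH h _)).
  by apply: finj; rewrite fM !fiK.
have act_odd h g : f (actH h g) = f g :> bool.
  apply/idP/idP; apply: contraTT => /negbTE ev; apply/negbT.
    exact: act_even.
  by rewrite -(actK actHP h g); apply: act_even.
have lambda_even k : f (lambda k) = false :> bool.
  elim/tensor_ind: k => [|g h u IH|g h u IH].
  - by rewrite gmulf1 f1 odd_perm1.
  - rewrite gmulfM lambdaE !fM fV !odd_permM odd_permV IH.
    by rewrite act_odd addbb.
  - rewrite gmulfM gmulfV lambdaE !(fM, fV) !(odd_permM, odd_permV) IH.
    by rewrite act_odd addbb.
have [|fpi fpiE] := @hom_of_morph E {perm 'I_n} (fun x => f (pi x)).
  by move=> x y; rewrite /= !gmulfM fM.
have n5 : 4 < n by case: n58 => [->//|]; apply: leq_trans.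
have simA : simple 'Alt_('I_n) by apply: simple_Alt5; rewrite card_ord.
have [D [nD piD Dpi]] := lambda_image.
have fD : f @* D <| 'Alt_('I_n).
  have nfD : f @* D <| [set: 'S_n] by rewrite -imf; apply: morphim_normal.
  apply/andP; split; last first.
    by apply: fintype.subset_trans (normal_norm nfD); apply: finset.subsetT.
  apply/fintype.subsetP => _ /morphimP[d _ /Dpi[x <-] ->].
  by rewrite Alt_even /pi /= lambda_even.
have [_ simP] := simpleP _ simA.
have [D1|DA] := simP _ fD.
  apply: trivial_case => x; apply: finj; rewrite f1; apply/set1gP.
  by rewrite -D1; apply: mem_morphim; rewrite ?inE.
apply: (alternating_derived (pi := fpi)) => //.
- by move=> x; rewrite fpiE lambda_even.
- move=> s evs; have : s \in f @* D by rewrite DA Alt_even evs.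
  by case/morphimP=> d _ /Dpi[x <-] ->; exists x.
- by move=> z; rewrite fpiE -f1 => /finj; apply: lambda_phi_central.
- by rewrite card_ord.
- by move=> x x1; rewrite fpiE /pi /= x1 gmulf1.
Qed.

End Cases.

Theorem corollary6p9 (G H : finGroupType)
    (actG : G -> H -> H) (actH : H -> G -> G)
    (actG_aut : left_action_by_aut actG)
    (actH_aut : left_action_by_aut actH)
    (compat : compatible_actions actG actH)
    (G_class :
      metacyclic [set: G]
      \/ (exists n : nat, (n = 5 \/ 8 <= n) /\ [set: G] \isog [set: 'S_n])
      \/ (simple [set: G] /\
          ((forall x : schur_multiplier G, x = 0%R)
           \/ zmod_isomorphic (schur_multiplier G) 'Z_2))) :
  bogomolov_multiplier (tensor actG actH) = [set 0%R]%classic.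
Proof.
apply: bogomolov_multiplier_trivial => E phi phi_surj phiCP.
have [lambda lambdaE] := tensor_lambda actH_aut compat.
case: G_class => [mG|[[n [n58 isoG]]|[simG schurG]]].
- exact: metacyclic_case compat lambda lambdaE E phi phi_surj phiCP mG.
- exact: symmetric_case n58 isoG.
- exact: simple_case simG schurG.
Qed.
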